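(* Let $P^{\mathrm{obs}}$ be the law of $W=(Y,X)$ and suppose its support $\mathcal W$ is compact. Fix $b\in\mathcal B$. With $\Theta_I$, $\mathcal X$, $K_b$ and $\Psi_b$ as defined in the context, $$b\in\Theta_I\quad\Longleftrightarrow\quad \Psi_b(\lambda)\ge 0\ \text{ for every }\lambda\in C_+(\mathcal X\times K_b)^{2T}.$$ If $b\notin\Theta_I$, there is some $\lambda\in C_+(\mathcal X\times K_b)^{2T}$ with $\Psi_b(\lambda)<0$.
   Context: $T,k\ge1$ are fixed integers, $\tau\in(0,1)$, $\mathcal B\subseteq\mathbb R^k$. $Y=(Y_1,\dots,Y_T)'\in\mathbb R^T$, $X=(X_1,\dots,X_T)$ with $X_t\in\mathbb R^k$, and $P^{\mathrm{obs}}$ is a Borel probability law of $W=(Y,X)$. Identified set: $\Theta_I$ is the set of $b\in\mathcal B$ for which there exists a Borel probability law $P^{\mathrm s}$ of $(Y,X,A,U)$, $A\in\mathbb R$, $U\in\mathbb R^T$, with $(Y,X)$-marginal $P^{\mathrm{obs}}$, with $Y_t=X_t'b+A+U_t$ a.s. for all $t$, and with $P^{\mathrm s}(U_t\le0\mid X,A)\ge\tau$, $P^{\mathrm s}(U_t<0\mid X,A)\le\tau$ a.s. for all $t$. (Equivalently, there is a law $\pi$ of $(Y,X,A)$ with $(Y,X)$-marginal $P^{\mathrm{obs}}$ and, for $R_t(b)=Y_t-X_t'b$, $\pi\{R_t(b)\le A\mid X,A\}\ge\tau$ and $\pi\{R_t(b)<A\mid X,A\}\le\tau$ a.s. for all $t$.)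 Dual objects: $\mathcal X$ is the support of $X$. $\underline r_b=\min_{(y,x)\in\mathcal W,\,1\le t\le T}(y_t-x_t'b)$, $\overline r_b=\max_{(y,x)\in\mathcal W,\,1\le t\le T}(y_t-x_t'b)$, $K_b=[\underline r_b,\overline r_b]$. $C_+(\mathcal X\times K_b)$ is the set of nonnegative continuous real functions on $\mathcal X\times K_b$. For $\lambda=(\lambda_t^-,\lambda_t^+)_{t=1}^T\in C_+(\mathcal X\times K_b)^{2T}$, $w=(y,x)$ and $a\in K_b$, $$S_b(w,a;\lambda)=\sum_{t=1}^T\Big[\lambda_t^-(x,a)\{\mathbf 1(y_t-x_t'b\le a)-\tau\}+\lambda_t^+(x,a)\{\tau-\mathbf 1(y_t-x_t'b<a)\}\Big],$$ and $\Psi_b(\lambda)=E_{P^{\mathrm{obs}}}\big[\max_{a\in K_b}S_b(W,a;\lambda)\big]$. *)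

(* Defs.v *)
From mathcomp Require Import all_boot all_order all_algebra.
From mathcomp Require Import all_classical all_reals all_analysis.

Set Implicit Arguments.
Unset Strict Implicit.
Unset Printing Implicit Defensive.

Import Order.TTheory GRing.Theory Num.Theory.
Import numFieldNormedType.Exports.

Local Open Scope classical_set_scope.
Local Open Scope ring_scope.

Notation borel T := (g_sigma_algebraType (@open T)).

(* Smallest closed set with null complement, for [mu] a law on a
   second-countable space. *)
Definition law_support (T : topologicalType) (R : realType)
    (mu : set T -> \bar R) : set T :=
  [set x | forall U : set T, open U -> U x -> (0 < mu U)%E].

(* [g \o Z] is a version of P(E | Z), i.e. of P(E | sigma(Z)). By the
   Doob-Dynkin lemma every version is of this form. *)
Definition cond_prob_version d d' (Omega : measurableType d)
    (S : measurableType d') (R : realType) (P : probability Omega R)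
    (Z : Omega -> S) (E : set Omega) (g : S -> R) : Prop :=
  [/\ measurable_fun setT g,
      P.-integrable setT (fun w => (g (Z w))%:E) &
      forall B : set S, measurable B ->
        (\int[P]_(w in Z @^-1` B) (g (Z w))%:E = P (E `&` Z @^-1` B))%E].

(* Versions of P(E | Z) are P-a.s. equal, so an a.s. bound on one of them is an
   a.s. bound on all of them. *)
Definition cond_prob_ge d d' (Omega : measurableType d)
    (S : measurableType d') (R : realType) (P : probability Omega R)
    (Z : Omega -> S) (E : set Omega) (tau : R) : Prop :=
  exists2 g : S -> R, cond_prob_version P Z E g &
    {ae P, forall w, tau <= g (Z w)}.

Definition cond_prob_le d d' (Omega : measurableType d)
    (S : measurableType d') (R : realType) (P : probability Omega R)
    (Z : Omega -> S) (E : set Omega) (tau : R) : Prop :=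
  exists2 g : S -> R, cond_prob_version P Z E g &
    {ae P, forall w, g (Z w) <= tau}.

Section Model.
Variables (R : realType) (T k : nat).

(* The t-th row of x : 'M_(T, k) is X_t', so that (x *m b) t 0 = X_t' b. *)
Definition obs := ('cV[R]_T * 'M[R]_(T, k))%type.

(* (Y, X, A, U) *)
Definition struct := ('cV[R]_T * 'M[R]_(T, k) * R * 'cV[R]_T)%type.

Definition sY (s : struct) : 'cV[R]_T := s.1.1.1.
Definition sX (s : struct) : 'M[R]_(T, k) := s.1.1.2.
Definition sA (s : struct) : R := s.1.2.
Definition sU (s : struct) : 'cV[R]_T := s.2.
Definition sW (s : borel struct) : borel obs := (sY s, sX s).
Definition sXA (s : borel struct) : borel ('M[R]_(T, k) * R)%type :=
  (sX s, sA s).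

Definition identified_set (tau : R) (calB : set 'cV[R]_k)
    (Pobs : probability (borel obs) R) : set 'cV[R]_k :=
  [set b | calB b /\
    exists Ps : probability (borel struct) R,
      [/\ forall C : set (borel obs), measurable C ->
            pushforward Ps sW C = Pobs C,
          forall t : 'I_T,
            {ae Ps, forall s, sY s t 0 = (sX s *m b) t 0 + sA s + sU s t 0},
          forall t : 'I_T,
            cond_prob_ge Ps sXA [set s | sU s t 0 <= 0] tau &
          forall t : 'I_T,
            cond_prob_le Ps sXA [set s | sU s t 0 < 0] tau]].

Definition residual (b : 'cV[R]_k) (w : obs) (t : 'I_T) : R :=
  w.1 t 0 - (w.2 *m b) t 0.

Variable Pobs : probability (borel obs) R.

Definition calW : set obs := law_support (Pobs : set obs -> \bar R).

Definition calX : set 'M[R]_(T, k) :=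
  law_support (pushforward Pobs
    (snd : borel obs -> borel 'M[R]_(T, k)) : set 'M[R]_(T, k) -> \bar R).

Definition residuals (b : 'cV[R]_k) : set R :=
  [set r | exists w t, calW w /\ r = residual b w t].

(* For compact [calW] and T > 0, [inf] and [sup] are attained: they are the
   minimum and the maximum. *)
Definition K (b : 'cV[R]_k) : set R :=
  `[inf (residuals b), sup (residuals b)].

(* [Cplus D] is C_+(D), a function on D being represented by any total
   extension of it. *)
Definition Cplus (E : topologicalType) (D : set E) : set (E -> R) :=
  [set f : E -> R | {within D, continuous f} /\ forall x, D x -> 0 <= f x].

(* lambda t = (lambda_t^-, lambda_t^+) *)
Definition multipliers :=
  'I_T -> ('M[R]_(T, k) * R -> R) * ('M[R]_(T, k) * R -> R).

Definition admissible (b : 'cV[R]_k) : set multipliers :=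
  [set lambda | forall t, Cplus (calX `*` K b) (lambda t).1 /\
                          Cplus (calX `*` K b) (lambda t).2].

Definition Sfun (tau : R) (b : 'cV[R]_k) (lambda : multipliers)
    (w : obs) (a : R) : R :=
  \sum_(t < T)
    ((lambda t).1 (w.2, a) * ((residual b w t <= a)%R%:R - tau) +
     (lambda t).2 (w.2, a) * (tau - (residual b w t < a)%R%:R)).

(* - For admissible [lambda] and w in [calW], [Sfun tau b lambda w] is upper
     semicontinuous on the compact [K b], so the [sup] is a maximum.
   - The expectation is taken over [calW], of probability one: when w.2 is not
     in [calX], [Sfun] evaluates the multipliers outside of their domain. *)
Definition Psi (tau : R) (b : 'cV[R]_k) (lambda : multipliers) : \bar R :=
  (\int[Pobs]_(w in (calW : set (borel obs)))
     (sup [set Sfun tau b lambda w a | a in K b])%:E)%E.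

End Model.

(* Main.v *)
From HB Require Import structures.
Require Import Defs.
From mathcomp Require Import all_boot all_order all_algebra.
From mathcomp Require Import all_classical all_reals all_analysis.
From mathcomp Require Import measurable_realfun ring lra.

Set Implicit Arguments.
Unset Strict Implicit.
Unset Printing Implicit Defensive.

Import Order.TTheory GRing.Theory Num.Theory.
Import numFieldNormedType.Exports.

Local Open Scope classical_set_scope.
Local Open Scope ring_scope.

(** The theorem is strong duality for an infinite-dimensional linear program. A feasible point is a
    law of $(W,A)$ with $W$-marginal $P^{\mathrm{obs}}$ under which, for each $t$, the event
    $R_t(b)\le A$ has conditional probability at least $\tau$ given $(X,A)$ and the event $A\le
    R_t(b)$ at least $1-\tau$. By [cond_prob_geP] and [cond_prob_leP], each constraint is an
    inequality $c\,P(Z\in B)\le P(E\cap\{Z\in B\})$ for all Borel $B$.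

    Necessity is weak duality. Integrating nonnegative multipliers against these inequalities gives
    $E\,S_b(W,A;\lambda)\ge0$. Moreover $A\in K_b$ almost surely, because outside $K_b$ a
    conditional probability bounded away from $0$ would vanish. Hence $S_b(W,A;\lambda)$ is at most
    its maximum over $K_b$, whose expectation is $\Psi_b(\lambda)$.

    For sufficiency, say that $c$ bounds a continuous $f$ if $f+S_b(\cdot;\lambda)\le G$ on
    $\mathcal W\times K_b$ for some multipliers $\lambda$ and some integrable $G(w)$ of mean $c$.
    Such bounds add and scale, and $\Psi_b\ge0$ makes every bound of $0$ nonnegative. So
    [hahn_banach_bounds] yields a linear functional $L$ on continuous functions that obeys all of
    them. With $\lambda=0$ the bounds make $L$ positive on the compact set $\mathcal W\times K_b$,
    of mass one, and [riesz_probability] attaches a probability $\mu$ to it. The bounds with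
    $\lambda=0$ and $G$ an indicator give the marginal ([functional_marginal]). Those with a single
    nonzero multiplier give the constraints ([functional_closed_constraint]).

    The indicators in $S_b$ are not continuous. They are, up to constants, indicators of closed
    sets, so the constraints on $L$ are stated for continuous majorants of them and passed to the
    limit along cutoffs. Finally $U_t=R_t(b)-A$ turns $\mu$ into a structural law
    ([identified_of_coupling]). *)

(** * Operations on continuous functions *)

Section continuous_real_functions.
Context (R : realType) (X : topologicalType).
Implicit Types f g : X -> R.

Lemma continuous_cstf (c : R) : continuous (fun _ : X => c).
Proof. by move=> x; exact: cvg_cst. Qed.

Lemma continuous_addf f g : continuous f -> continuous g ->
  continuous (fun x => f x + g x).
Proof. by move=> cf cg x; apply: cvgD; [exact: cf|exact: cg]. Qed.

Lemma continuous_oppf f : continuous f -> continuous (fun x => - f x).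
Proof. by move=> cf x; apply: cvgN; exact: cf. Qed.

Lemma continuous_subf f g : continuous f -> continuous g ->
  continuous (fun x => f x - g x).
Proof. by move=> cf cg x; apply: cvgB; [exact: cf|exact: cg]. Qed.

Lemma continuous_mulf f g : continuous f -> continuous g ->
  continuous (fun x => f x * g x).
Proof. by move=> cf cg x; apply: cvgM; [exact: cf|exact: cg]. Qed.

End continuous_real_functions.

Lemma continuous_compf (X Y Z : topologicalType) (f : X -> Y) (g : Y -> Z) :
  continuous f -> continuous g -> continuous (fun x => g (f x)).
Proof. by move=> cf cg x; apply: continuous_comp; [exact: cf|exact: cg]. Qed.

Lemma continuous_pairf (X Y Z : topologicalType) (f : X -> Y) (g : X -> Z) :
  continuous f -> continuous g -> continuous (fun x => (f x, g x)).
Proof. by move=> cf cg x; exact: (cvg_pair (cf x) (cg x)). Qed.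

Lemma continuous_sumf (R : realType) (X : topologicalType) (I : Type) (r : seq I)
    (f : I -> X -> R) : (forall i, continuous (f i)) ->
  continuous (fun x => \sum_(i <- r) f i x).
Proof.
move=> cf; elim: r => [|i r IH].
  rewrite (_ : (fun x => _) = fun=> 0); first by move=> x; exact: cvg_cst.
  by apply/funext => x; rewrite big_nil.
rewrite (_ : (fun x => _) = fun x => f i x + \sum_(j <- r) f j x).
  by move=> x; apply: cvgD; [exact: cf|exact: IH].
by apply/funext => x; rewrite big_cons.
Qed.


(** * The Hahn-Banach theorem through minimal sublinear functionals *)

Section hahn_banach.
Context (R : realType) (V : lmodType R) (D : set V).
Hypotheses (DD : forall x y, D x -> D y -> D (x + y))
  (DZ : forall a x, D x -> D (a *: x)).

Definition sublinear_on (q : V -> R) :=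
  (forall x y, D x -> D y -> q (x + y) <= q x + q y) /\
  (forall a x, 0 < a -> D x -> q (a *: x) = a * q x).

Let DN x : D x -> D (- x). Proof. by move=> Dx; rewrite -scaleN1r; apply: DZ. Qed.

Lemma sublinear_on0 q x : sublinear_on q -> D x -> q 0 = 0.
Proof.
move=> [_ qZ] Dx; have D0 : D 0 by rewrite -(scale0r x); apply: DZ.
have /qZ/(_ D0) : (0 : R) < 2 by [].
by rewrite scaler0; lra.
Qed.

Lemma sublinear_on_ge q x : sublinear_on q -> D x -> - q (- x) <= q x.
Proof.
move=> qS Dx; have := qS.1 _ _ Dx (DN Dx).
by rewrite subrr (sublinear_on0 qS Dx); lra.
Qed.

(** Zorn's lemma for the reversed pointwise order. A chain is bounded by its pointwise infimum,
    which is finite because each member satisfies $q(x)\ge-q(-x)\ge-p(-x)$. *)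
Lemma minimal_sublinear p : sublinear_on p -> exists q, [/\ sublinear_on q,
  forall x, D x -> q x <= p x & forall r, sublinear_on r ->
    (forall x, D x -> r x <= q x) -> forall x, D x -> q x <= r x].
Proof.
move=> pS.
pose T := {q : V -> R | sublinear_on q /\ forall x, D x -> q x <= p x}.
pose mk q (qS : sublinear_on q) (qp : forall x, D x -> q x <= p x) : T :=
  exist _ q (conj qS qp).
pose rel_ : rel T := fun q r => `[< forall x, D x -> sval r x <= sval q x >].
have p0 : T by exists p; split.
have [| | |q qmin] := @ZL_preorder T p0 rel_.
- by move=> q; apply/asboolP.
- move=> q r s /asboolP qr /asboolP rs; apply/asboolP => x Dx.
  exact: le_trans (rs _ Dx) (qr _ Dx).
- move=> A Atot; have [[q0 Aq0]|A0] := pselect (A !=set0); last first.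
    by exists p0 => s As; exfalso; apply: A0; exists s.
  pose E x := [set sval q x | q in A].
  have E0 x : E x !=set0 by exists (sval q0 x); exists q0.
  have Elb x : D x -> lbound (E x) (- p (- x)).
    move=> Dx _ [[q [qS qp]] /= _ <-].
    by apply: le_trans (sublinear_on_ge qS Dx); rewrite lerN2; apply/qp/DN.
  have Ele q x : D x -> A q -> inf (E x) <= sval q x.
    move=> Dx Aq; apply: ge_inf; first by exists (- p (- x)); exact: Elb.
    by exists q.
  have ilin : sublinear_on (fun x => inf (E x)).
    split=> [x y Dx Dy|a x a0 Dx].
      apply/ler_addgt0Pr => e e0.
      have e20 : 0 < e / 2 by rewrite divr_gt0.
      have hx : has_inf (E x) by split=> //; exists (- p (- x)); exact: Elb.
      have hy : has_inf (E y) by split=> //; exists (- p (- y)); exact: Elb.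
      have [_ [q Aq <-] qx] := inf_adherent e20 hx.
      have [_ [r Ar <-] ry] := inf_adherent e20 hy.
      (* The two near-minimizers, at [x] and at [y], are comparable in the chain, so the smaller one
         serves at both points. *)
      have [s [As sq sr]] : exists s, [/\ A s, sval s x <= sval q x &
          sval s y <= sval r y].
        by have [/asboolP h|/asboolP h] := Atot _ _ Aq Ar;
          [exists r|exists q]; split=> //; apply: h.
      have := Ele _ _ (DD Dx Dy) As.
      have := (svalP s).1.1 _ _ Dx Dy; lra.
    have Dax := DZ a Dx; apply/eqP; rewrite eq_le; apply/andP; split.
      rewrite -ler_pdivrMl//; apply: lb_le_inf => // _ [q Aq <-].
      by rewrite ler_pdivrMl// -(svalP q).1.2//; exact: Ele.
    apply: lb_le_inf => // _ [q Aq <-].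
    by rewrite (svalP q).1.2// ler_wpM2l ?(ltW a0)//; exact: Ele.
  have ip x : D x -> inf (E x) <= p x.
    by move=> Dx; apply: le_trans (Ele _ _ Dx Aq0) ((svalP q0).2 _ Dx).
  exists (mk _ ilin ip) => s As; apply/asboolP => x Dx /=.
  exact: Ele.
- exists (sval q); split; [exact: (svalP q).1|exact: (svalP q).2|].
  move=> r rS rq.
  have rp x : D x -> r x <= p x.
    by move=> Dx; apply: le_trans (rq _ Dx) ((svalP q).2 _ Dx).
  by have /(_ (asboolT rq))/asboolP := qmin (mk _ rS rp).
Qed.

(* For a minimal q, the sublinear functional x |-> inf_(t >= 0) (q (x + t y) - t q y)
   lies below q, hence equals q; t = 1 gives additivity. *)
Lemma minimal_sublinearD q : sublinear_on q ->
  (forall r, sublinear_on r ->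
    (forall x, D x -> r x <= q x) -> forall x, D x -> q x <= r x) ->
  forall x y, D x -> D y -> q (x + y) = q x + q y.
Proof.
move=> qS qmin x y Dx Dy; apply/eqP; rewrite eq_le qS.1//=.
pose E x := [set q (x + t *: y) - t * q y | t in [set t | 0 <= t]].
have E0 z : E z !=set0 by exists (q (z + 0 *: y) - 0 * q y); exists 0 => /=.
have qty t : 0 <= t -> q (t *: y) = t * q y.
  rewrite le_eqVlt => /orP[/eqP<-|t0]; last exact: qS.2.
  by rewrite scale0r mul0r (sublinear_on0 qS Dy).
have Elb z : D z -> lbound (E z) (- q (- z)).
  move=> Dz _ [t /= t0 <-].
  have := qS.1 _ _ (DD Dz (DZ t Dy)) (DN Dz).
  by rewrite addrAC subrr add0r qty//; lra.
have Ele z t : D z -> 0 <= t -> inf (E z) <= q (z + t *: y) - t * q y.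
  move=> Dz t0; apply: ge_inf; first by exists (- q (- z)); exact: Elb.
  by exists t.
suff /qmin : sublinear_on (fun z => inf (E z)).
  have rq z : D z -> inf (E z) <= q z.
    by move=> Dz; have := Ele z 0 Dz (lexx _); rewrite scale0r mul0r addr0 subr0.
  move=> /(_ rq _ Dx)/le_trans => /(_ _ (Ele _ 1 Dx ler01)).
  by rewrite scale1r mul1r; lra.
split=> [z w Dz Dw|a z a0 Dz].
  apply/ler_addgt0Pr => e e0.
  have e20 : 0 < e / 2 by rewrite divr_gt0.
  have hz : has_inf (E z) by split=> //; exists (- q (- z)); exact: Elb.
  have hw : has_inf (E w) by split=> //; exists (- q (- w)); exact: Elb.
  have [_ [t /= t0 <-] tz] := inf_adherent e20 hz.
  have [_ [s /= s0 <-] sw] := inf_adherent e20 hw.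
  have := Ele (z + w) (t + s) (DD Dz Dw) (addr_ge0 t0 s0).
  have := qS.1 _ _ (DD Dz (DZ t Dy)) (DD Dw (DZ s Dy)).
  by rewrite addrACA -scalerDl; lra.
have Daz := DZ a Dz; apply/eqP; rewrite eq_le; apply/andP; split.
  rewrite -ler_pdivrMl//; apply: lb_le_inf => // _ [t /= t0 <-].
  rewrite ler_pdivrMl//.
  have := Ele (a *: z) (a * t) Daz (mulr_ge0 (ltW a0) t0).
  have Dzt : D (z + t *: y) by apply: DD => //; exact: DZ.
  by rewrite -scalerA -scalerDr qS.2// mulrBr mulrA.
apply: lb_le_inf => // _ [t /= t0 <-].
have := Ele z (a^-1 * t) Dz (mulr_ge0 (ltW _) t0); rewrite invr_gt0 => /(_ a0).
rewrite -(ler_pM2l a0) => /le_trans; apply.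
have Dzt : D (z + (a^-1 * t) *: y) by apply: DD => //; exact: DZ.
have qa := qS.2 _ _ a0 Dzt.
by rewrite mulrBr -qa scalerDr scalerA !mulrA mulfV ?gt_eqF// !mul1r.
Qed.

(** A minimal sublinear functional below [p] is additive, hence odd, and oddness extends positive
    homogeneity to all scalars. *)
Theorem hahn_banach p : sublinear_on p -> exists L : V -> R,
  [/\ forall x y, D x -> D y -> L (x + y) = L x + L y,
      forall a x, D x -> L (a *: x) = a * L x &
      forall x, D x -> L x <= p x].
Proof.
move=> /minimal_sublinear[L [LS Lp Lmin]].
have LD := minimal_sublinearD LS Lmin.
exists L; split=> // a x Dx.
have LN y : D y -> L (- y) = - L y.
  move=> Dy; have := LD _ _ Dy (DN Dy).
  by rewrite subrr (sublinear_on0 LS Dy); lra.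
have Lpos c y : 0 < c -> D y -> L (c *: y) = c * L y by exact: LS.2.
have [a0|a0|->] := ltgtP a 0.
- have Na0 : 0 < - a by rewrite oppr_gt0.
  by have := LN _ (DZ (- a) Dx); rewrite Lpos// scaleNr opprK mulNr opprK.
- exact: Lpos.
- by rewrite scale0r mul0r (sublinear_on0 LS Dx).
Qed.

(* [B x c] reads: c is an upper bound imposed on the functional at x. *)
Lemma hahn_banach_bounds (B : V -> R -> Prop) :
  (forall x y c d, D x -> D y -> B x c -> B y d -> B (x + y) (c + d)) ->
  (forall a x c, D x -> 0 < a -> B x c -> B (a *: x) (a * c)) ->
  (forall x, D x -> exists c, B x c) ->
  (forall c, B 0 c -> 0 <= c) ->
  exists L : V -> R,
  [/\ forall x y, D x -> D y -> L (x + y) = L x + L y,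
      forall a x, D x -> L (a *: x) = a * L x &
      forall x c, D x -> B x c -> L x <= c].
Proof.
move=> BD BZ Bex B0.
(* If [c] is a bound at [x] and [d] one at [- x], then [c + d] is a bound at [0], so [- d <= c]. The
   infimum of the bounds at [x] is therefore finite, and it is the sublinear functional to
   dominate. *)
have lb x : D x -> exists d, lbound (B x) (- d).
  move=> Dx; have [d Bd] := Bex _ (DN Dx); exists d => c Bc.
  have := BD _ _ _ _ Dx (DN Dx) Bc Bd.
  by rewrite subrr => /B0; lra.
have hi x : D x -> has_inf (B x).
  move=> Dx; split; first exact: Bex.
  by have [d ?] := lb _ Dx; exists (- d).
have le x c : D x -> B x c -> inf (B x) <= c.
  by move=> Dx Bc; apply: ge_inf => //; exact: (hi _ Dx).2.
have : sublinear_on (fun x => inf (B x)).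
  split=> [x y Dx Dy|a x a0 Dx].
    apply/ler_addgt0Pr => e e0.
    have e20 : 0 < e / 2 by rewrite divr_gt0.
    have [c Bc cx] := inf_adherent e20 (hi _ Dx).
    have [d Bd dy] := inf_adherent e20 (hi _ Dy).
    by have := le _ _ (DD Dx Dy) (BD _ _ _ _ Dx Dy Bc Bd); lra.
  have Dax := DZ a Dx; apply/eqP; rewrite eq_le; apply/andP; split.
    rewrite -ler_pdivrMl//; apply: lb_le_inf; first exact: Bex.
    move=> c Bc; rewrite ler_pdivrMl//; apply: le => //; exact: BZ.
  apply: lb_le_inf; first exact: Bex.
  move=> c Bc; rewrite -ler_pdivlMl//; apply: le => //.
  have -> : x = a^-1 *: (a *: x) by rewrite scalerA mulVf ?gt_eqF// scale1r.
  by apply: BZ; rewrite ?invr_gt0.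
move=> /hahn_banach[L [LD LZ Lp]]; exists L; split=> // x c Dx Bc.
exact: le_trans (Lp _ Dx) (le _ _ Dx Bc).
Qed.

End hahn_banach.

(** * Borel sets and continuous approximations of closed sets *)

Section borel_sets.
Context (R : realType) (V W : normedModType R).

Lemma open_borel (U : set V) : open U -> measurable (U : set (borel V)).
Proof. by move=> oU; exact: sub_sigma_algebra. Qed.

Lemma closed_borel (F : set V) : closed F -> measurable (F : set (borel V)).
Proof.
move=> cF; have := open_borel (closed_openC cF).
by move=> /measurableC; rewrite setCK.
Qed.

Lemma continuous_borel_measurable (f : V -> W) : continuous f ->
  measurable_fun [set: borel V] (f : borel V -> borel W).
Proof.
move=> /continuousP cf; apply: (@measurability _ _ (borel V) (borel W) setT f (@open W)) => //.
move=> _ [U oU <-].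
by rewrite setTI; exact: open_borel (cf _ oU).
Qed.

Lemma continuous_real_measurable (f : V -> R) : continuous f ->
  measurable_fun [set: borel V] (f : borel V -> R).
Proof.
move=> /continuousP cf.
apply: (measurability _ (RGenOInfty.measurableE R)) => // _ [_ [x ->] <-].
by rewrite setTI; exact: open_borel (cf _ (rray_open x)).
Qed.

(** The function is the distance to [F], which is 1-Lipschitz. For empty [F] the infimum would
    default to 0, so the constant 1 replaces it. *)
Lemma closed_zero_set (F : set V) : closed F -> exists d : V -> R,
  [/\ continuous d, forall x, 0 <= d x & forall x, d x = 0 <-> F x].
Proof.
move=> cF; have [[y0 Fy0]|F0] := pselect (F !=set0); last first.
  exists (fun=> 1); split=> // [x|x]; first exact: cvg_cst.
  by split=> [/eqP|Fx]; [rewrite oner_eq0|exfalso; apply: F0; exists x].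
pose E x := [set `|x - y| | y in F].
have hE x : has_inf (E x).
  by split; [exists `|x - y0|, y0|exists 0 => _ [y _ <-]].
have dle x y : F y -> inf (E x) <= `|x - y|.
  by move=> Fy; apply: (ge_inf (hE x).2); exists y.
have lip x z : inf (E x) <= `|x - z| + inf (E z).
  rewrite -lerBlDl; apply: lb_le_inf; first exact: (hE z).1.
  move=> _ [y Fy <-]; rewrite lerBlDl; apply: le_trans (dle _ _ Fy) _.
  by rewrite -[x - y](subrKA z) ler_normD.
exists (fun x => inf (E x)); split=> [x|x|x].
- apply/cvgrPdist_lt => e e0; near=> z.
  have xz : `|x - z| < e by near: z; apply: cvgr_dist_lt.
  have := lip x z; have := lip z x; rewrite distrC => h1 h2.
  by apply: le_lt_trans xz; rewrite ler_norml; apply/andP; split; lra.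
- by apply: lb_le_inf; [exact: (hE x).1|move=> _ [y _ <-]].
- split=> [dx0|Fx]; last first.
    apply/eqP; rewrite eq_le; apply/andP; split.
      by have := dle x x Fx; rewrite subrr normr0.
    by apply: lb_le_inf; [exact: (hE x).1|move=> _ [y _ <-]].
  apply: cF => U /nbhs_ballP[e /= e0 xeU].
  have [_ [y Fy <-] ye] := inf_adherent e0 (hE x).
  by exists y; split=> //; apply: xeU; rewrite -ball_normE /=; move: ye; rewrite dx0 add0r.
Unshelve. all: by end_near. Qed.

End borel_sets.

(* The tents [cutoff d m] decrease to the indicator of the zero set of [d]. *)
Definition cutoff (R : realType) (V : Type) (d : V -> R) (m : nat) (x : V) : R :=
  Num.max 0 (1 - m%:R * d x).

Section cutoff.
Context (R : realType) (V : normedModType R) (d : V -> R).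
Hypotheses (cd : continuous d) (d_ge0 : forall x, 0 <= d x).

Lemma continuous_cutoff m : continuous (cutoff d m).
Proof.
move=> x.
apply: (@continuous_max R V (fun=> 0) (fun x => 1 - m%:R * d x)).
  exact: cvg_cst.
by apply: cvgB; [exact: cvg_cst|apply: cvgM; [exact: cvg_cst|exact: cd]].
Qed.

Lemma cutoff_ge0 m x : 0 <= cutoff d m x.
Proof. by rewrite le_max lexx. Qed.

Lemma cutoff_le1 m x : cutoff d m x <= 1.
Proof. by rewrite ge_max ler01 /= gerBl mulr_ge0. Qed.

Lemma cutoff1 m x : d x = 0 -> cutoff d m x = 1.
Proof. by move=> dx; rewrite /cutoff dx mulr0 subr0 max_r. Qed.

Lemma cutoff_gt0 m x : (0 < cutoff d m x) = (m%:R * d x < 1).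
Proof. by rewrite lt_max ltxx /= subr_gt0. Qed.

Lemma measurable_cutoff_gt0 m :
  measurable ([set x | 0 < cutoff d m x] : set (borel V)).
Proof.
have /continuousP/(_ _ (@open_gt R 0)) := @continuous_cutoff m.
exact: open_borel.
Qed.

(** The open sets $\{m\,d<1\}$ decrease to $\{d=0\}$, so this is continuity from above of a finite
    measure. *)
Lemma cvg_cutoff_gt0 (mu : {measure set (borel V) -> \bar R}) :
  (mu setT < +oo)%E ->
  mu [set x | 0 < cutoff d m x] @[m --> \oo] --> mu [set x | d x = 0].
Proof.
move=> mufin.
have -> : [set x | d x = 0] = \bigcap_m [set x | 0 < cutoff d m x].
  apply/seteqP; split=> [x /= dx m _ /=|x /= h]; first by rewrite cutoff1.
  apply/eqP; rewrite eq_le d_ge0 andbT leNgt; apply/negP => dx0.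
  have := h (Num.bound (d x)^-1) I.
  rewrite /= cutoff_gt0 -ltr_pdivlMr// div1r ltNge => /negP; apply.
  by apply: ltW; by apply: archi_boundP; rewrite invr_ge0.
apply: nonincreasing_cvg_mu.
- by apply: le_lt_trans mufin; apply: le_measure; rewrite ?inE//;
    exact: measurable_cutoff_gt0.
- exact: measurable_cutoff_gt0.
- by apply: bigcapT_measurable => m; exact: measurable_cutoff_gt0.
- move=> m n mn; apply/subsetPset => x /=; rewrite !cutoff_gt0.
  by apply: le_lt_trans; rewrite ler_wpM2r// ler_nat.
Qed.

End cutoff.

(** * Inner regularity of finite Borel measures by closed sets *)

Section closed_regularity.
Context (R : realType) (V : normedModType R).

Definition inner_closed (mu : set (borel V) -> \bar R) (B : set V) :=
  forall e : R, 0 < e -> exists F : set V,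
    [/\ closed F, F `<=` B & (mu (B `\` F) < e%:E)%E].

Context (mu : {finite_measure set (borel V) -> \bar R}).

(** The complement of [U] is the limit of a decreasing sequence of open sets. The complement of one
    of them with small excess mass is a closed subset of [U]. *)
Lemma inner_closed_open (U : set V) : open U -> inner_closed mu U.
Proof.
move=> oU e e0; have mufin : (mu setT < +oo)%E by exact: fin_num_fun_lty.
have [d [cd d0 dF]] := closed_zero_set (open_closedC oU).
have := cvg_cutoff_gt0 cd d0 mufin.
have -> : [set x | d x = 0] = ~` U by apply/seteqP; split=> x /dF.
move=> cvmu; have mU := open_borel oU.
have mC : measurable (~` U : set (borel V)) by exact: measurableC.
have fC : mu (~` U) \is a fin_num by exact: fin_num_measure.
have := cvmu [set y : \bar R | (y < mu (~` U) + e%:E)%E] _.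
case.
  apply: open_nbhs_nbhs; split; first exact: open_ereal_lt_ereal.
  by rewrite /= lteDl.
move=> m _ /(_ m (leqnn m)) /= mum.
exists (~` [set x | 0 < cutoff d m x]); split.
- apply: open_closedC.
  have cc : continuous (cutoff d m) by exact: continuous_cutoff.
  by have /continuousP/(_ _ (@open_gt R 0)) := cc.
- move=> x /= h; apply: contrapT => nUx; apply: h.
  by rewrite cutoff1//; apply/dF.
- rewrite setDE setCK.
  have ME : [set x | 0 < cutoff d m x] =
      ~` U `|` (U `&` [set x | 0 < cutoff d m x]).
    apply/seteqP; split=> [x /= h|x /= [nUx|[]//]].
      by have [Ux|nUx] := pselect (U x); [right|left].
    by rewrite cutoff1//; apply/dF.
  have mc := measurable_cutoff_gt0 cd m.
  have mUc := measurableI _ _ mU mc.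
  have UU0 : ~` U `&` (U `&` [set x | 0 < cutoff d m x]) = set0.
    by apply/seteqP; split=> x //= [nUx []].
  by move: mum; rewrite [in X in X -> _]ME (measureU mu mC mUc UU0) lteD2lE.
Qed.

Let small_choice (B : (set V)^nat) (e : R) : 0 < e ->
  (forall n, inner_closed mu (B n)) -> {F : (set V)^nat &
  forall n, [/\ closed (F n), F n `<=` B n &
    (mu (B n `\` F n) <= (e / (2 ^ n.+1)%:R)%:E)%E]}.
Proof.
move=> e0 iB; apply: (@choice _ _ (fun n F => [/\ closed F, F `<=` B n &
    (mu (B n `\` F) <= (e / (2 ^ n.+1)%:R)%:E)%E])) => n.
have [|F [cF FB muF]] := iB n (e / (2 ^ n.+1)%:R).
  by rewrite divr_gt0// ltr0n expn_gt0.
by exists F; split=> //; exact: ltW.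
Qed.

Let small_bigcup (B F : (set V)^nat) (e : R) : 0 < e ->
  (forall n, measurable (B n : set (borel V))) ->
  (forall n, [/\ closed (F n), F n `<=` B n &
    (mu (B n `\` F n) <= (e / (2 ^ n.+1)%:R)%:E)%E]) ->
  (mu (\bigcup_n (B n `\` F n)) <= e%:E)%E.
Proof.
move=> e0 mB FB.
have mBF n : measurable (B n `\` F n : set (borel V)).
  by apply: measurableD => //; apply: closed_borel; have [] := FB n.
apply: le_trans (measure_sigma_subadditive _ mBF _ (@subset_refl _ _)) _.
  exact: bigcupT_measurable.
have := @epsilon_trick R (fun=> 0%E) e xpredT (fun=> lexx _) (ltW e0).
rewrite [X in (_ <= X + _)%E]eseries0// add0e; apply: le_trans.
by apply: lee_nneseries => // n _; rewrite add0e; have [] := FB n.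
Qed.

Lemma inner_closed_bigcap (B : (set V)^nat) :
  (forall n, measurable (B n : set (borel V))) ->
  (forall n, inner_closed mu (B n)) -> inner_closed mu (\bigcap_n B n).
Proof.
move=> mB iB e e0; have e20 : 0 < e / 2 by rewrite divr_gt0.
have [F FB] := small_choice e20 iB.
have cF n : closed (F n) by have [] := FB n.
have mF n : measurable (F n : set (borel V)) by exact: closed_borel.
exists (\bigcap_n F n); split.
- by apply: closed_bigI => n _.
- by move=> x Fx n _; have [_ + _] := FB n; apply; exact: Fx.
- apply: (@le_lt_trans _ _ (e / 2)%:E); last by rewrite lte_fin; lra.
  apply: le_trans (small_bigcup e20 mB FB); apply: le_measure; rewrite ?inE.
  + by apply: measurableD; apply: bigcapT_measurable.
  + by apply: bigcupT_measurable => n; exact: measurableD.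
  + move=> x [Bx nFx]; apply: contrapT => nU; apply: nFx => n _.
    apply: contrapT => nFx; apply: nU; exists n => //; split=> //; exact: Bx.
Qed.

(** A countable union of closed sets need not be closed, so the approximants are the finite unions
    [G N]. In the limit they miss mass at most [e / 2], which leaves room for a finite [N]. *)
Lemma inner_closed_bigcup (B : (set V)^nat) :
  (forall n, measurable (B n : set (borel V))) ->
  (forall n, inner_closed mu (B n)) -> inner_closed mu (\bigcup_n B n).
Proof.
move=> mB iB e e0; have e20 : 0 < e / 2 by rewrite divr_gt0.
have [F FB] := small_choice e20 iB.
have cF n : closed (F n) by have [] := FB n.
have mF n : measurable (F n : set (borel V)) by exact: closed_borel.
pose G N := \big[setU/set0]_(n < N) F n.
have mG N : measurable (G N : set (borel V)) by exact: bigsetU_measurable.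
have mUB : measurable (\bigcup_n B n : set (borel V)).
  exact: bigcupT_measurable.
have mD : measurable (\bigcap_N (\bigcup_n B n `\` G N) : set (borel V)).
  by apply: bigcapT_measurable => N; exact: measurableD.
have Dle : (mu (\bigcap_N (\bigcup_n B n `\` G N)) < e%:E)%E.
  apply: (@le_lt_trans _ _ (e / 2)%:E); last by rewrite lte_fin; lra.
  apply: le_trans (small_bigcup e20 mB FB); apply: le_measure; rewrite ?inE//.
    by apply: bigcupT_measurable => n; exact: measurableD.
  move=> x Dx; have [[n _ Bnx] _] := Dx 0%N I.
  exists n => //; split=> // Fnx; have [_] := Dx n.+1 I; apply.
  by rewrite /G big_ord_recr /=; right.
have : mu (\bigcup_n B n `\` G N) @[N --> \oo] -->
    mu (\bigcap_N (\bigcup_n B n `\` G N)).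
  apply: nonincreasing_cvg_mu => //.
  - apply: (@le_lt_trans _ _ (mu setT)); last exact: fin_num_fun_lty.
    by apply: le_measure; rewrite ?inE//; exact: measurableD.
  - by move=> N; exact: measurableD.
  - move=> m n mn; apply/subsetPset => x [Bx nGx]; split=> // Gx; apply: nGx.
    exact: (@subset_bigsetU _ F _ _ mn x Gx).
move=> /(_ [set y : \bar R | (y < e%:E)%E]) [].
  by apply: open_nbhs_nbhs; split=> //; exact: open_ereal_lt_ereal.
move=> N _ /(_ N (leqnn N)) /= GN; exists (G N); split=> //.
- by apply: closed_bigsetU => n _.
- rewrite /G => x; rewrite -bigcup_mkord => -[n _ Fnx]; exists n => //.
  by have [_ + _] := FB n; apply.
Qed.

(** The sets that are inner regular together with their complements form a sigma-algebra, and it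
    contains the open sets. *)
Lemma inner_closed_borel (B : set V) :
  measurable (B : set (borel V)) -> inner_closed mu B.
Proof.
pose P : set (set V) := [set B | [/\ measurable (B : set (borel V)),
  inner_closed mu B & inner_closed mu (~` B)]].
suff h : <<s @open V >> `<=` P by move=> /h[].
apply: smallest_sub; last first.
  move=> U oU; split; [exact: open_borel|exact: inner_closed_open|].
  move=> e e0; exists (~` U); split=> //; first exact: open_closedC.
  by rewrite setDv measure0.
split.
- split=> //; first last.
    move=> e e0; exists (~` set0); split=> //; first by rewrite setC0; exact: closedT.
    by rewrite setDv measure0.
  move=> e e0; exists set0; split=> //; first exact: closed0.
  by rewrite setDv measure0.
- move=> A [mA iA iCA]; rewrite setTD; split=> //; first exact: measurableC.
  by rewrite setCK.
- move=> A PA; split.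
  + by apply: bigcupT_measurable => n; have [] := PA n.
  + by apply: inner_closed_bigcup => n; have [] := PA n.
  + rewrite setC_bigcup; apply: inner_closed_bigcap => n; have [] := PA n => //.
    by move=> mA _ _; exact: measurableC.
Qed.

(** Approximation of [B] from inside within [e / c] makes the neglected part of [c * mu B] at most
    [e]. Cutoffs only reach closed sets; this lemma carries the marginal and the constraints to all
    Borel sets. *)
Lemma le_measure_closed (nu : {measure set (borel V) -> \bar R}) (c : R) :
  0 < c -> (forall F : set V, closed F -> (c%:E * mu F <= nu F)%E) ->
  forall B : set (borel V), measurable B -> (c%:E * mu B <= nu B)%E.
Proof.
move=> c0 munu B mB; apply/lee_addgt0Pr => e e0.
have [F [cF FB muF]] := inner_closed_borel mB (divr_gt0 e0 c0).
have mF := closed_borel cF.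
have mBF : measurable (B `\` F : set (borel V)) by exact: measurableD.
have FB0 : F `&` (B `\` F) = set0 by apply/seteqP; split=> x // [Fx []].
have muB : (mu B = mu F + mu (B `\` F))%E by rewrite -measureU// setDUK.
rewrite muB ge0_muleDr//; apply: leeD.
  apply: le_trans (munu _ cF) _; apply: le_measure; rewrite ?inE//.
apply: le_trans (lee_wpmul2l _ (ltW muF)) _; first by rewrite lee_fin ltW.
by rewrite -EFinM mulrC divfK ?gt_eqF.
Qed.

End closed_regularity.

(** * Sums of nonnegative families indexed by the natural numbers *)

Section esum_nat.
Context (R : realType).

Lemma esum_single (a : \bar R) : (0 <= a)%E ->
  \esum_(n in [set: nat]) (if n == 0%N then a else 0%E) = a.
Proof.
move=> a0; rewrite (esumID [set 0%N]); last by move=> n _; case: ifP.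
rewrite setTI esum_set1// esum1 ?adde0// => n [_ /= n0].
by case: eqP.
Qed.

(** This merges countably many countable covers into one. The enumeration [f] is chosen before [a],
    since the same one must serve for the values of the functions and for their images under the
    functional. *)
Lemma esum_pairing : exists f : nat -> nat * nat, forall a : nat -> nat -> \bar R,
  (forall i j, 0 <= a i j)%E ->
  \esum_(n in setT) a (f n).1 (f n).2 = \esum_(i in setT) \esum_(j in setT) a i j.
Proof.
have /card_esym/ppcard_eqP[f] := card_nat2.
exists f => a a0; rewrite esum_esum//.
rewrite (_ : [set: nat] `*`` _ = setT); last by apply/seteqP; split.
by rewrite (@reindex_esum _ _ _ setT setT f) //; exact: bijTT.
Qed.

Lemma esum_nat_le (a : nat -> \bar R) (c : \bar R) : (forall n, 0 <= a n)%E ->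
  (forall n, \sum_(i < n) a i <= c)%E -> (\esum_(n in setT) a n <= c)%E.
Proof.
move=> a0 ac; rewrite -nneseries_esumT//; apply: lime_le.
  exact: is_cvg_nneseries.
by apply: nearW => n; rewrite big_mkord.
Qed.

Lemma esum_nat_ge (a : nat -> \bar R) n : (forall n, 0 <= a n)%E ->
  (\sum_(i < n) a i <= \esum_(n in setT) a n)%E.
Proof.
move=> a0; rewrite -nneseries_esumT// -(big_mkord xpredT a).
by apply: nneseries_lim_ge => *; exact: a0.
Qed.

End esum_nat.

(** * A probability attached to a positive functional *)

Section riesz.
Context (R : realType) (V : normedModType R) (Q : set V) (L : (V -> R) -> R).
Hypotheses (cQ : compact Q)
  (LD : forall f g : V -> R, continuous f -> continuous g ->
    L (fun x => f x + g x) = L f + L g)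
  (LZ : forall (a : R) (f : V -> R), continuous f -> L (fun x => a * f x) = a * L f)
  (L_ge0 : forall f : V -> R, continuous f -> (forall x, Q x -> 0 <= f x) -> 0 <= L f)
  (L1 : L (fun=> 1) = 1).

Let continuous_cst (c : R) : continuous (fun _ : V => c).
Proof. exact: continuous_cstf. Qed.

Let L0 : L (fun=> 0) = 0.
Proof.
by have := LZ 0 (@continuous_cst 1); rewrite !mul0r.
Qed.

Let LN (f : V -> R) : continuous f -> L (fun x => - f x) = - L f.
Proof.
move=> cf; have := LZ (-1) cf; rewrite mulN1r => <-; congr L.
by apply/funext => x; rewrite mulN1r.
Qed.

Let L_le (f g : V -> R) : continuous f -> continuous g -> (forall x, Q x -> f x <= g x) ->
  L f <= L g.
Proof.
move=> cf cg fg; rewrite -subr_ge0 -(LN cf) -LD//; last exact: continuous_oppf.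
apply: L_ge0 => [|x Qx]; first by apply: continuous_addf => //; exact: continuous_oppf.
by rewrite subr_ge0 fg.
Qed.

Let L_sum (g : nat -> V -> R) n : (forall i, continuous (g i)) ->
  continuous (fun x => \sum_(i < n) g i x) /\
  L (fun x => \sum_(i < n) g i x) = \sum_(i < n) L (g i).
Proof.
move=> cg; elim: n => [|n [cn Ln]].
  have -> : (fun x => \sum_(i < 0) g i x) = fun=> 0.
    by apply/funext => x; rewrite big_ord0.
  by rewrite big_ord0.
have -> : (fun x => \sum_(i < n.+1) g i x) =
    fun x => \sum_(i < n) g i x + g n x.
  by apply/funext => x; rewrite big_ord_recr.
by rewrite big_ord_recr /= LD// Ln; split=> //; exact: continuous_addf.
Qed.

Definition function_cover (A : set V) : set (nat -> V -> R) :=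
  [set g : nat -> V -> R | [/\ forall n, continuous (g n), forall n x, 0 <= g n x &
    forall x, A x -> (1 <= \esum_(n in setT) (g n x)%:E)%E]].

(** Covering by continuous functions instead of open sets lets [L] itself be the cost of a cover, so
    countable subadditivity only requires merging covers. *)
Definition riesz_outer (A : set V) : \bar R :=
  ereal_inf [set \esum_(n in setT) (L (g n))%:E | g in function_cover A].

Let LE_ge0 A g n : function_cover A g -> (0 <= (L (g n))%:E)%E.
Proof. by move=> [cg g0 _]; rewrite lee_fin; exact: L_ge0. Qed.

Lemma riesz_outer_ge0 A : (0 <= riesz_outer A)%E.
Proof.
apply: le_ereal_inf_tmp => _ [g gA <-]; apply: esum_ge0 => n _.
exact: LE_ge0 gA.
Qed.

Lemma le_riesz_outer : {homo riesz_outer : A B / A `<=` B >-> (A <= B)%E}.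
Proof.
move=> A B AB; apply: ereal_inf_le_tmp => _ [g [cg g0 gB] <-].
by exists g => //; split=> // x /AB/gB.
Qed.

Lemma riesz_outer_le A (f : V -> R) : continuous f -> (forall x, 0 <= f x) ->
  (forall x, A x -> 1 <= f x) -> (riesz_outer A <= (L f)%:E)%E.
Proof.
move=> cf f0 fA; apply: ereal_inf_lbound.
exists (fun n => if n == 0%N then f else fun=> 0).
  split=> [n|n x|x Ax]; [by case: ifP|by case: ifP|].
  rewrite (eq_esum (b := fun n => if n == 0%N then (f x)%:E else 0%E)).
    by rewrite esum_single ?lee_fin//; exact: fA.
  by move=> n _; case: ifP.
rewrite (eq_esum (b := fun n => if n == 0%N then (L f)%:E else 0%E)).
  by rewrite esum_single// lee_fin; exact: L_ge0.
by move=> n _; case: ifP => // _; rewrite L0.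
Qed.

Lemma riesz_outer0 : riesz_outer set0 = 0%E.
Proof.
apply/eqP; rewrite eq_le riesz_outer_ge0 andbT.
by apply: le_trans (riesz_outer_le (f := fun=> 0) _ _ _) _; rewrite ?L0.
Qed.

Lemma riesz_outer_fin_num A : riesz_outer A \is a fin_num.
Proof.
rewrite ge0_fin_numE ?riesz_outer_ge0//; apply: (@le_lt_trans _ _ 1%:E).
  by rewrite -L1; apply: riesz_outer_le.
by rewrite ltry.
Qed.

Lemma riesz_outer_sigma_subadditive : sigma_subadditive riesz_outer.
Proof.
move=> A; apply/lee_addgt0Pr => e e0.
apply: le_trans; last first.
  by apply: epsilon_trick; [move=> n; exact: riesz_outer_ge0|exact: ltW].
pose P n g := function_cover (A n) g /\ (\esum_(k in setT) (L (g k))%:E <=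
  riesz_outer (A n) + (e / (2 ^ n.+1)%:R)%:E)%E.
have [G PG] : {G : nat -> nat -> V -> R & forall n, P n (G n)}.
  apply: (@choice _ _ P) => n.
  have en : 0 < e / (2 ^ n.+1)%:R by rewrite divr_gt0// ltr0n expn_gt0.
  have [_ [g gA <-] gn] := lb_ereal_inf_adherent en (riesz_outer_fin_num (A n)).
  by exists g; split=> //; exact: ltW.
have G0 i j x : 0 <= G i j x by have [[_ + _] _] := PG i.
have LG0 i j : (0 <= (L (G i j))%:E)%E by apply: LE_ge0 (PG i).1.
have [f fE] := esum_pairing R.
apply: (@le_trans _ _ (\esum_(i in setT) \esum_(j in setT) (L (G i j))%:E)).
  rewrite -fE//; apply: ereal_inf_lbound.
  exists (fun n => G (f n).1 (f n).2) => //; split=> // [n|x [i _ Ax]].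
    by have [[]] := PG (f n).1.
  rewrite (fE (fun i j => (G i j x)%:E)); last by move=> *; rewrite lee_fin.
  have [[_ _ GA] _] := PG i; apply: le_trans (GA _ Ax) _.
  apply: esum_ge; exists [set i]; first by split.
  by rewrite fsbig_set1.
rewrite -nneseries_esumT; last by move=> n; apply: esum_ge0.
by apply: lee_nneseries => n *; [apply: esum_ge0|exact: (PG n).2].
Qed.

HB.instance Definition _ := isOuterMeasure.Build R V riesz_outer
  riesz_outer0 riesz_outer_ge0 le_riesz_outer riesz_outer_sigma_subadditive.


(* [1 - cutoff d m] increases to the indicator of the complement of {d = 0};
   its increments turn a cover of [X] into a cover of [X] minus {d = 0}. *)
Lemma riesz_outer_cozero (d : V -> R) : continuous d -> (forall x, 0 <= d x) ->
  riesz_outer.-caratheodory [set x | d x != 0].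
Proof.
move=> cd d0; apply: le_caratheodory_measurable => X.
have cc m : continuous (cutoff d m) by exact: continuous_cutoff.
apply: le_ereal_inf_tmp => _ [g gX <-]; have [cg g0 gX1] := gX.
set S := \esum_(_ in _) _.
pose incr k x := cutoff d k x - cutoff d k.+1 x.
have cincr k : continuous (incr k).
  by apply: continuous_addf => //; exact: continuous_oppf.
have incr0 k x : 0 <= incr k x.
  rewrite subr_ge0 ge_max cutoff_ge0/= le_max; apply/orP; right.
  by rewrite lerB// ler_wpM2r// ler_nat.
have sum_incr m x : \sum_(k < m) incr k x = 1 - cutoff d m x.
  rewrite (eq_bigr (fun k : 'I_m => - (cutoff d k.+1 x - cutoff d k x))).
    rewrite sumrN -(big_mkord xpredT (fun k => cutoff d k.+1 x - cutoff d k x)).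
    rewrite telescope_sumr// opprB; congr (_ - _).
    by rewrite /cutoff mul0r subr0 max_r.
  by move=> k _; rewrite opprB.
pose h k n x := incr k x * g n x.
have ch k n : continuous (h k n) by exact: continuous_mulf.
have h0 k n x : 0 <= h k n x by exact: mulr_ge0.
pose a k : \bar R := \esum_(n in setT) (L (h k n))%:E.
have Lh0 k n : (0 <= (L (h k n))%:E)%E by rewrite lee_fin; exact: L_ge0.
have a0 k : (0 <= a k)%E by exact: esum_ge0.
(* Where [d x != 0], the cutoff vanishes once [m] exceeds the inverse of [d x]. The first [m]
   increments then sum to 1 and the products [h k n] still cover. *)
have XU : (riesz_outer (X `&` [set x | d x != 0%R]) <= \esum_(k in setT) a k)%E.
  have [f fE] := esum_pairing R; rewrite -fE//; apply: ereal_inf_lbound.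
  exists (fun n => h (f n).1 (f n).2) => //; split=> // x [Xx /= dx0].
  rewrite (fE (fun k n => (h k n x)%:E)); last by move=> *; rewrite lee_fin.
  have [m cm0] : exists m, cutoff d m x = 0.
    exists (Num.bound (d x)^-1); apply: max_l; rewrite subr_le0.
    have dx_gt0 : 0 < d x by rewrite lt_neqAle eq_sym dx0 d0.
    rewrite -ler_pdivrMr// div1r; apply: ltW.
    by apply: archi_boundP; rewrite invr_ge0.
  apply: le_trans (esum_nat_ge m _); last first.
    by move=> k; apply: esum_ge0 => n _; rewrite lee_fin.
  rewrite -esum_sum; last by move=> *; rewrite lee_fin.
  apply: le_trans (gX1 _ Xx) _; apply: le_esum => n _.
  by rewrite sumEFin lee_fin -mulr_suml sum_incr cm0 subr0 mul1r.
have XF m : (riesz_outer (X `&` ~` [set x | d x != 0%R]) <=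
    \esum_(n in setT) (L (fun x => cutoff d m x * g n x))%:E)%E.
  apply: ereal_inf_lbound; exists (fun n x => cutoff d m x * g n x) => //.
  split=> [n|n x|x [Xx /= /negP]]; first exact: continuous_mulf.
    by rewrite mulr_ge0// cutoff_ge0.
  rewrite negbK => /eqP dx0; apply: le_trans (gX1 _ Xx) _.
  by apply: le_esum => n _; rewrite cutoff1// mul1r.
have fF := riesz_outer_fin_num (X `&` ~` [set x | d x != 0%R]).
(* Finiteness of the second outer measure allows it to be moved across. For fixed [m], the first [m]
   increments and [cutoff d m] sum to 1, so together the two families distribute exactly [g n]. *)
rewrite -leeBrDr//; apply: le_trans XU _; apply: esum_nat_le => // m.
rewrite leeBrDr//; apply: le_trans (leeD2l _ (XF m)) _.
rewrite -esum_sum// -esumD//; first last.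
- move=> n _; rewrite lee_fin; apply: L_ge0 => [|x _]; first exact: continuous_mulf.
  by rewrite mulr_ge0// cutoff_ge0.
- by move=> n _; exact: sume_ge0.
apply: le_esum => n _; rewrite sumEFin -EFinD lee_fin.
have [chs <-] := L_sum m (fun k => @ch k n).
rewrite -LD//; last exact: continuous_mulf.
apply: L_le => [||x _]; [apply: continuous_addf => //; exact: continuous_mulf|exact: cg|].
by rewrite -mulr_suml sum_incr -mulrDl subrK mul1r.
Qed.

(** The lower bound is where compactness of [Q] enters. The partial sums of a cover increase, so a
    single one exceeds [1 - e] on all of [Q], and positivity of [L] relative to [Q] gives a cost of
    at least [1 - e]. *)
Lemma riesz_outer_setT : riesz_outer setT = 1%E.
Proof.
apply/eqP; rewrite eq_le; apply/andP; split.
  by rewrite -[leRHS]/(1%:E) -L1; apply: riesz_outer_le.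
apply: le_ereal_inf_tmp => _ [g gT <-]; have [cg g0 gT1] := gT.
apply/lee_addgt0Pr => e e0.
pose s N x := \sum_(n < N) g n x.
have [cs Ls] : (forall N, continuous (s N)) /\
    forall N, L (s N) = \sum_(n < N) L (g n).
  by split=> N; have [] := L_sum N cg.
have [N Ns] : exists N, forall x, Q x -> 1 - e < s N x.
  have /compact_near_coveringP := cQ.
  move=> /(_ nat \oo (fun N x => 1 - e < s N x) _) [].
    move=> x Qx.
    have [M xM] : exists M, 1 - e < s M x.
      apply: contrapT => /forallNP h; have := gT1 x I; apply/negP.
      rewrite -ltNge; apply: (@le_lt_trans _ _ (1 - e)%:E); last first.
        by rewrite lte_fin; lra.
      apply: esum_nat_le => [n|n]; first by rewrite lee_fin.
      by rewrite sumEFin lee_fin leNgt; apply/negP/h.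
    have nM : \forall y \near x, 1 - e < s M y.
      by apply: (cvgr_gt (s M x)) => //; exact: cs.
    near=> x' N => /=.
    apply: (@lt_le_trans _ _ (s M x')).
      by near: x'.
    have MN : (M <= N)%N by near: N; exact: nbhs_infty_ge.
    by rewrite /s -(subnKC MN) big_split_ord/= lerDl sumr_ge0.
  by move=> N _ /(_ N (leqnn N)) Ns; exists N => x /Ns.
apply: (@le_trans _ _ ((L (s N))%:E + e%:E)%E).
  rewrite -EFinD lee_fin -lerBlDr.
  have -> : 1 - e = L (fun=> 1 - e).
    by have := LZ (1 - e) (@continuous_cst 1); rewrite L1 mulr1.
  by apply: L_le => // x /Ns/ltW.
rewrite leeD2r// Ls -sumEFin.
by apply: (@esum_nat_ge _ (fun n => (L (g n))%:E)) => n; exact: LE_ge0 gT.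
Unshelve. all: by end_near. Qed.

(** Every open set is the set where the distance to its complement is nonzero, and Caratheodory sets
    form a sigma-algebra. *)
Lemma riesz_outer_borel (B : set V) : measurable (B : set (borel V)) ->
  riesz_outer.-caratheodory B.
Proof.
move: B; apply: smallest_sub.
  split.
  - exact: caratheodory_measurable_set0.
  - by move=> A; rewrite setTD; exact: caratheodory_measurable_setC.
  - by move=> A; exact: caratheodory_measurable_bigcup.
move=> U oU; have [d [cd d0 dU]] := closed_zero_set (open_closedC oU).
have -> : U = [set x | d x != 0].
  apply/seteqP; split=> x /=; first by move=> Ux; apply/eqP => /dU.
  by move=> /eqP dx0; apply: contrapT => nUx; apply/dx0/dU.
exact: riesz_outer_cozero.
Qed.

Definition riesz_measure : set (borel V) -> \bar R := riesz_outer.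

Let riesz_measure_sigma_additive : semi_sigma_additive riesz_measure.
Proof.
move=> F mF tF mUF.
apply: (@caratheodory_measure_sigma_additive R V riesz_outer) => //.
  by move=> n; exact: riesz_outer_borel.
exact: riesz_outer_borel.
Qed.

HB.instance Definition _ := isMeasure.Build _ _ _ riesz_measure
  riesz_outer0 riesz_outer_ge0 riesz_measure_sigma_additive.
HB.instance Definition _ :=
  Measure_isProbability.Build _ _ _ riesz_measure riesz_outer_setT.

(** Full representation of [L] as an integral is replaced by this one-sided estimate. Applied to
    [1 - g] on complements it also yields lower bounds on [mu]. *)
Theorem riesz_probability : exists mu : probability (borel V) R,
  forall (A : set V) (f : V -> R), continuous f -> (forall x, 0 <= f x) ->
    (forall x, A x -> 1 <= f x) -> (mu A <= (L f)%:E)%E.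
Proof. by exists riesz_measure; exact: riesz_outer_le. Qed.

End riesz.

(** * Conditional probabilities as inequalities between measures *)

Section restricted_law.
Context d d' (Omega : measurableType d) (S : measurableType d') (R : realType).
Context (P : {finite_measure set Omega -> \bar R}) (Z : Omega -> S).
Context (E : set Omega).
Hypotheses (mZ : measurable_fun setT Z) (mE : measurable E).

(** For [E = setT] this is the law of [Z]; in general it is the measure whose density with respect
    to that law is $P(E\mid Z)$. *)
Definition restricted_law (B : set S) : \bar R := P (E `&` Z @^-1` B).

Let mZB (B : set S) : measurable B -> measurable (Z @^-1` B).
Proof. by move=> mB; rewrite -[X in measurable X]setTI; exact: mZ. Qed.

Let restricted_law0 : restricted_law set0 = 0%E.
Proof. by rewrite /restricted_law preimage_set0 setI0 measure0. Qed.

Let restricted_law_ge0 B : (0 <= restricted_law B)%E.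
Proof. exact: measure_ge0. Qed.

Let restricted_law_sigma_additive : semi_sigma_additive restricted_law.
Proof.
move=> F mF tF mUF; rewrite /restricted_law preimage_bigcup setI_bigcupr.
apply: measure_semi_sigma_additive.
- by move=> n; apply: measurableI => //; exact: mZB.
- apply/trivIsetP => /= i j _ _ ij; rewrite setIACA -preimage_setI.
  by move/trivIsetP : tF => /(_ _ _ _ _ ij) ->//; rewrite preimage_set0 setI0.
- by apply: bigcupT_measurable => n; apply: measurableI => //; exact: mZB.
Qed.

HB.instance Definition _ := isMeasure.Build _ _ _ restricted_law
  restricted_law0 restricted_law_ge0 restricted_law_sigma_additive.

Let restricted_law_fin : fin_num_fun restricted_law.
Proof.
move=> B mB; apply: fin_num_measure; apply: measurableI => //; exact: mZB.
Qed.

HB.instance Definition _ :=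
  Measure_isFinite.Build _ _ _ restricted_law restricted_law_fin.

Lemma restricted_law_measure : exists m : {finite_measure set S -> \bar R},
  forall B, m B = P (E `&` Z @^-1` B).
Proof. by exists restricted_law. Qed.

End restricted_law.

Section conditional_probability.
Context d d' (Omega : measurableType d) (S : measurableType d') (R : realType).
Context (P : probability Omega R) (Z : Omega -> S) (E : set Omega).
Hypotheses (mZ : measurable_fun setT Z) (mE : measurable E).

Let mZB (B : set S) : measurable B -> measurable (Z @^-1` B).
Proof. by move=> mB; rewrite -[X in measurable X]setTI; exact: mZ. Qed.

Lemma cond_prob_version_ge g (B : set S) (c : R) : cond_prob_version P Z E g ->
  measurable B -> (forall s, B s -> c <= g s) ->
  (c%:E * P (Z @^-1` B) <= P (E `&` Z @^-1` B))%E.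
Proof.
move=> [mg ig gE] mB cg; rewrite -gE// -integral_cst; last exact: mZB.
apply: le_integral; first exact: mZB.
- exact/finite_measure_integrable_cst/mZB.
- by apply: integrableS ig => //; exact: mZB.
- by move=> w; rewrite inE => Bw; rewrite lee_fin; exact: cg.
Qed.

Lemma cond_prob_version_le g (B : set S) (c : R) : cond_prob_version P Z E g ->
  measurable B -> (forall s, B s -> g s <= c) ->
  (P (E `&` Z @^-1` B) <= c%:E * P (Z @^-1` B))%E.
Proof.
move=> [mg ig gE] mB cg; rewrite -gE// -integral_cst; last exact: mZB.
apply: le_integral; first exact: mZB.
- by apply: integrableS ig => //; exact: mZB.
- exact/finite_measure_integrable_cst/mZB.
- by move=> w; rewrite inE => Bw; rewrite lee_fin; exact: cg.
Qed.

(** The version is the Radon-Nikodym derivative of the law of [Z] restricted to [E] with respect to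
    the law of [Z]. *)
Lemma cond_prob_version_exists : exists g, cond_prob_version P Z E g.
Proof.
have [PZ PZE] := restricted_law_measure P mZ measurableT.
have [nu nuE] := restricted_law_measure P mZ mE.
have PZT B : PZ B = P (Z @^-1` B) by rewrite PZE setTI.
have dom : nu `<< PZ.
  apply/null_content_dominatesP => B mB PZB0.
  have {}PZB0 : P (Z @^-1` B) = 0%E by rewrite -PZT; exact: PZB0.
  suff : P (E `&` Z @^-1` B) = 0%E by rewrite -nuE.
  apply/eqP; rewrite eq_le measure_ge0 andbT -PZB0.
  apply: le_measure; rewrite ?inE; [|exact: mZB|exact: subIsetr].
  exact: measurableI mE (mZB mB).
pose f := Radon_Nikodym_SigmaFinite.f nu PZ.
have f0 := Radon_Nikodym_SigmaFinite.f_ge0 dom.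
have ffin := Radon_Nikodym_SigmaFinite.f_fin_num dom.
have fint := Radon_Nikodym_SigmaFinite.f_integrable dom.
have mf : measurable_fun setT f by exact: measurable_int fint.
have gE (B : set S) : measurable B ->
    (\int[P]_(w in Z @^-1` B) (fine (f (Z w)))%:E = P (E `&` Z @^-1` B))%E.
  move=> mB; rewrite -nuE (Radon_Nikodym_SigmaFinite.f_integral dom)//.
  transitivity (\int[pushforward P Z]_(s in B) f s)%E.
    rewrite ge0_integral_pushforward//; last exact: measurable_funTS.
    by apply: eq_integral => w _; rewrite fineK.
  by apply: eq_measure_integral => A mA _; exact: esym (PZT A).
exists (fine \o f); split=> //.
- by apply: measurableT_comp.
- apply/integrableP; split.
    apply/measurable_EFinP; apply: measurableT_comp => //.
    exact: measurableT_comp.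
  under eq_integral => w _ do rewrite gee0_abs ?lee_fin ?fine_ge0//.
  by have := gE setT measurableT; rewrite preimage_setT setIT => ->; rewrite -ge0_fin_numE ?fin_num_measure.
Qed.

Let ae_lower (B : set S) (c : R) g : cond_prob_version P Z E g ->
  {ae P, forall w, c <= g (Z w)} -> measurable B ->
  exists2 C, measurable C /\ (forall s, C s -> c <= g s) &
    C `<=` B /\ P (Z @^-1` B) = P (Z @^-1` C).
Proof.
move=> [mg _ _] gc mB.
have mC : measurable [set s | c <= g s].
  by rewrite -[X in measurable X]setTI; apply: measurable_fun_le.
exists (B `&` [set s | c <= g s]).
  by split; [exact: measurableI|move=> s []].
split; first exact: subIsetl.
apply/eqP; rewrite eq_le; apply/andP; split; last first.
  apply: le_measure; rewrite ?inE; [apply: mZB; exact: measurableI|exact: mZB|].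
  by move=> w [].
have [N [mN N0 gN]] := gc.
rewrite -[leRHS]adde0 -N0; apply: le_trans (measureU2 _ _ _) => //; last first.
  by apply: mZB; exact: measurableI.
apply: le_measure; rewrite ?inE; [exact: mZB|apply: measurableU => //|].
  by apply: mZB; exact: measurableI.
move=> w Bw; have [h|h] := pselect (c <= g (Z w)); first by left.
by right; exact: gN.
Qed.

(** This removes the versions from the constraints. Conversely, on the event that a version is at
    most $c-1/(n+1)$ the inequality forces mass zero, and these events exhaust the failure of the
    bound. *)
Lemma cond_prob_geP (c : R) : cond_prob_ge P Z E c <->
  forall B, measurable B -> (c%:E * P (Z @^-1` B) <= P (E `&` Z @^-1` B))%E.
Proof.
split=> [[g gv gc] B mB|h].
  have [C [mC gC] [CB ->]] := ae_lower gv gc mB.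
  apply: le_trans (cond_prob_version_ge gv mC gC) _.
  apply: le_measure; rewrite ?inE; [| |by move=> w [Ew /CB]].
    by apply: measurableI => //; exact: mZB.
  by apply: measurableI => //; exact: mZB.
have [g gv] := cond_prob_version_exists; exists g => //.
have [mg _ _] := gv.
pose B n := [set s | g s <= c - n.+1%:R^-1].
have mB n : measurable (B n).
  by rewrite -[X in measurable X]setTI; apply: measurable_fun_le.
apply: (@negligibleS _ _ _ _ (\bigcup_n Z @^-1` (B n))).
  move=> w /= /negP; rewrite -ltNge -subr_gt0 => gc.
  exists (Num.bound (c - g (Z w))^-1) => //=; rewrite /B /= lerBrDr -lerBrDl.
  rewrite invf_ple ?posrE//; apply: ltW.
  apply: le_lt_trans (ltW (archi_boundP _)) _; rewrite ?invr_ge0 ?(ltW gc)//.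
  by rewrite ltr_nat.
apply: negligible_bigcup => n; apply/negligibleP; first exact: mZB.
have := le_trans (h _ (mB n)) (cond_prob_version_le gv (mB n) (fun s => id)).
have fB : P (Z @^-1` B n) \is a fin_num by apply: fin_num_measure; exact: mZB.
rewrite -(fineK fB) -!EFinM lee_fin mulrBl lerBrDr gerDl => h0.
have P0 : fine (P (Z @^-1` B n)) = 0.
  apply/eqP; rewrite eq_le fine_ge0 ?measure_ge0// andbT.
  by move: h0; rewrite pmulr_rle0 ?invr_gt0.
by have := fineK fB; rewrite P0 => /esym.
Qed.

End conditional_probability.

(** If [g] is a version for [E], then [1 - g] is one for its complement. Thus only lower bounds have
    to be treated, and the strict event $U_t<0$ is replaced by the closed one $U_t\ge0$. *)
Lemma cond_prob_leP d d' (Omega : measurableType d) (S : measurableType d')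
    (R : realType) (P : probability Omega R) (Z : Omega -> S) (E : set Omega)
    (c : R) : measurable_fun setT Z -> measurable E ->
  cond_prob_le P Z E c <-> cond_prob_ge P Z (~` E) (1 - c).
Proof.
move=> mZ mE.
have mZB (B : set S) : measurable B -> measurable (Z @^-1` B).
  by move=> mB; rewrite -[X in measurable X]setTI; exact: mZ.
have compl (F : set Omega) g : measurable F -> cond_prob_version P Z F g ->
    cond_prob_version P Z (~` F) (fun s => 1 - g s).
  move=> mF [mg ig gE]; split.
  - by apply: measurable_funB.
  - have -> : (fun w => (1 - g (Z w))%:E) =
        ((EFin \o cst 1%R) \- (fun w => (g (Z w))%:E))%E by apply/funext => w.
    by apply: integrableB => //; exact: finite_measure_integrable_cst.
  - move=> B mB; under eq_integral => w _ do rewrite EFinB.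
    rewrite integralB//; [|exact: mZB| |]; last 2 first.
    + by apply: finite_measure_integrable_cst; exact: mZB.
    + by apply: integrableS ig => //; exact: mZB.
    rewrite gE// integral_cst ?mul1e; last exact: mZB.
    have mFB := measurableI _ _ mF (mZB _ mB).
    have mFCB := measurableI _ _ (measurableC mF) (mZB _ mB).
    have fFB : P (F `&` Z @^-1` B) \is a fin_num by exact: fin_num_measure.
    have split_F : (P (F `&` Z @^-1` B) + P (~` F `&` Z @^-1` B))%E =
        P (Z @^-1` B).
      rewrite -measureU//; last by apply/seteqP; split=> w // [[? ?] []].
      congr (P _); apply/seteqP; split=> w /=; first by case=> -[].
      by move=> Bw; have [Fw|nFw] := pselect (F w); [left|right].
    transitivity (P (F `&` Z @^-1` B) + P (~` F `&` Z @^-1` B) -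
        P (F `&` Z @^-1` B))%E; first by congr (_ - _)%E; exact: esym split_F.
    by rewrite addeAC subee// add0e.
split=> [[g gv gc]|[g gv gc]].
  exists (fun s => 1 - g s); first exact: compl.
  by apply: filterS gc => w; rewrite lerD2l lerN2.
exists (fun s => 1 - g s); first by rewrite -[E]setCK; apply: compl => //; exact: measurableC.
by apply: filterS gc => w /=; lra.
Qed.

(** * The support of a law is closed and has full mass *)

Section law_support.
Context (R : realType) (V : normedModType R) (P : probability (borel V) R).

Lemma closed_law_support : closed (law_support (P : set V -> \bar R)).
Proof.
set W := law_support _.
have -> : W = ~` \bigcup_(U in [set U | open U /\ ~ (0 < P U)%E]) U.
  apply/seteqP; split=> [x Wx [U [oU nU] Ux]|x nx U oU Ux]; first exact/nU/Wx.
  by apply: contrapT => nU; apply: nx; exists U.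
by apply: open_closedC; apply: bigcup_open => U [].
Qed.

(** Each point outside the support has a null neighbourhood, hence lies in a null ball with centre
    some [q i] and radius $1/(n+1)$; there are countably many such balls. *)
Lemma law_support_full (I : countType) (q : I -> V) :
  (forall x e, 0 < e -> exists i, ball x e (q i)) ->
  P (law_support (P : set V -> \bar R)) = 1%E.
Proof.
move=> dense_q; set W := law_support _.
have mW : measurable (W : set (borel V)) by apply: closed_borel; exact: closed_law_support.
suff nW : P (~` W) = 0%E.
  by have := probability_setC P (measurableC mW); rewrite setCK nW sube0.
apply/negligibleP; first exact: measurableC.
pose F m : set V := if (unpickle m : option (I * nat)) is Some (i, n) then
  (if `[< P (ball (q i) n.+1%:R^-1) = 0%E >] then ball (q i) n.+1%:R^-1 else set0)
  else set0.
apply: (@negligibleS _ (borel V) R P (\bigcup_m F m)); last first.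
  apply: negligible_bigcup => m; rewrite /F; case: unpickle => [[i n]|].
    case: asboolP => [P0|_]; last exact: negligible_set0.
    by apply/negligibleP => //; exact: open_borel (ball_open _ _).
  exact: negligible_set0.
move=> x /existsNP[U /not_implyP[oU /not_implyP[Ux nU]]].
have [e /= e0 xeU] := (nbhs_ballP _ _).1 (open_nbhs_nbhs (conj oU Ux)).
(* This choice gives $2/(n+1)<e$, so a ball of radius $1/(n+1)$ that contains [x] stays inside the
   [e]-ball around [x], hence inside [U]. *)
pose n := Num.bound (2 / e).
have n2 : n.+1%:R^-1 + n.+1%:R^-1 < e.
  have : 2 / e < n.+1%:R.
    apply: lt_le_trans (archi_boundP _) _; first by rewrite divr_ge0// ltW.
    by rewrite ler_nat.
  rewrite ltr_pdivrMr// -ltr_pdivrMl// mulrC => h.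
  by rewrite -mulr2n -(mulr_natl _ 2).
have n0 : 0 < n.+1%:R^-1 :> R by rewrite invr_gt0.
have [i xqi] := dense_q x _ n0.
exists (pickle (i, n)) => //; rewrite /F pickleK.
case: asboolP => [_|]; first exact: ball_sym.
case; apply/eqP; rewrite eq_le measure_ge0 andbT.
have mU := open_borel oU.
apply: (@le_trans _ _ (P U)); last by rewrite leNgt; apply/negP.
apply: le_measure; rewrite ?inE//; first exact: open_borel (ball_open _ _).
move=> y qy; apply: xeU; apply: le_ball (ltW n2) _ _.
exact: ball_triangle xqi qy.
Qed.

End law_support.

(** * Upper semicontinuity and measurability of suprema *)

Section semicontinuity.
Context (R : realType).

Definition usc_on (X : topologicalType) (Q : set X) (f : X -> R) :=
  forall x, Q x -> forall e, 0 < e -> \forall y \near x, Q y -> f y < f x + e.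

Lemma usc_on_continuous (X : topologicalType) (Q : set X) (f : X -> R) :
  {within Q, continuous f} -> usc_on Q f.
Proof.
move=> /subspace_continuousP cf x Qx e e0.
have := cf x Qx [set z | z < f x + e] _; apply.
apply: open_nbhs_nbhs; split; first exact: open_lt.
by rewrite /= ltrDl.
Qed.

Lemma usc_onD (X : topologicalType) (Q : set X) (f g : X -> R) :
  usc_on Q f -> usc_on Q g -> usc_on Q (fun x => f x + g x).
Proof.
move=> uf ug x Qx e e0; have e20 : 0 < e / 2 by rewrite divr_gt0.
near=> y => Qy.
have fy : Q y -> f y < f x + e / 2 by near: y; exact: uf.
have gy : Q y -> g y < g x + e / 2 by near: y; exact: ug.
have := fy Qy; have := gy Qy; lra.
Unshelve. all: by end_near. Qed.

Lemma usc_on_sum (X : topologicalType) (Q : set X) n (f : 'I_n -> X -> R) :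
  (forall i, usc_on Q (f i)) -> usc_on Q (fun x => \sum_(i < n) f i x).
Proof.
elim: n f => [|n IH] f uf.
  by move=> x Qx e e0; near=> y => _; rewrite !big_ord0 add0r.
rewrite (_ : (fun x => _) =
    fun x => \sum_(i < n) f (widen_ord (leqnSn n) i) x + f ord_max x).
  by apply: usc_onD => //; exact: IH.
by apply/funext => x; rewrite big_ord_recr.
Unshelve. all: by end_near. Qed.

(** At a point of [E], leaving [E] can only lower the product since [f] is nonnegative; off [E] the
    product vanishes on a whole neighbourhood. *)
Lemma usc_on_restrict (X : topologicalType) (Q E : set X) (f : X -> R) :
  closed E -> {within Q, continuous f} -> (forall x, Q x -> 0 <= f x) ->
  usc_on Q (fun x => f x * (x \in E)%:R).
Proof.
move=> cE cf f0 x Qx e e0; case: (boolP (x \in E)) => [_|].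
  rewrite mulr1; near=> y => Qy.
  have fy : Q y -> f y < f x + e by near: y; exact: usc_on_continuous.
  apply: le_lt_trans (fy Qy); case: (y \in E); rewrite ?mulr1 ?mulr0//.
  exact: f0.
rewrite notin_setE => nEx; have := open_nbhs_nbhs (conj (closed_openC cE) nEx).
apply: filterS => y nEy Qy; rewrite memNset// !mulr0 add0r//.
Unshelve. all: by end_near. Qed.

Lemma compact_superlevel (X : topologicalType) (Q : set X) (f : X -> R) (c : R) :
  hausdorff_space X -> compact Q -> usc_on Q f ->
  compact (Q `&` [set x | c <= f x]).
Proof.
move=> hX cQ uf; apply: (@subclosed_compact _ _ Q) => //.
move=> x clx; have Qx : Q x.
  by apply: (compact_closed hX cQ); apply: closureS clx; exact: subIsetl.
split=> //=; rewrite leNgt; apply/negP => fxc.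
have e0 : 0 < c - f x by rewrite subr_gt0.
have [y [[Qy /= cy] /(_ Qy)]] := clx _ (uf x Qx _ e0).
by move=> fy; have := le_lt_trans cy fy; rewrite subrKC ltxx.
Qed.

Lemma within_compact_bounded (X : topologicalType) (Q : set X) (f : X -> R) :
  compact Q -> {within Q, continuous f} -> exists C, forall x, Q x -> `|f x| <= C.
Proof.
move=> cQ cf; have /compact_bounded[C [_ Cf]] := continuous_compact cf cQ.
exists (C + 1) => x Qx; apply: (Cf (C + 1)); first by rewrite ltrDl.
by exists x.
Qed.

Lemma within_continuous_comp (X Y : topologicalType) (Q : set X) (D : set Y)
    (h : X -> Y) (f : Y -> R) : continuous h -> (forall x, Q x -> D (h x)) ->
  {within D, continuous f} -> {within Q, continuous (f \o h)}.
Proof.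
move=> ch QD /subspace_continuousP cf; apply/subspace_continuousP => x Qx U.
move=> /(cf _ (QD _ Qx)) fU; have hU : nbhs x [set y | D (h y) -> U (f (h y))] := ch x _ fU.
have : nbhs x [set y | Q y -> U (f (h y))]; last by [].
by apply: filterS hU => y /= hy Qy; apply/hy/QD.
Qed.

Context (V1 V2 : normedModType R) (A : set V1) (K : set V2) (f : V1 * V2 -> R).
Hypotheses (cA : compact A) (cK : compact K) (K0 : K !=set0)
  (uf : usc_on (A `*` K) f) (C : R)
  (fC : forall w a, A w -> K a -> `|f (w, a)| <= C).

Let has_sup_section w : A w -> has_sup [set f (w, a) | a in K].
Proof.
move=> Aw; split; first by have [a Ka] := K0; exists (f (w, a)), a.
by exists C => _ [a Ka <-]; apply: le_trans (ler_norm _) (fC _ _).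
Qed.

Lemma le_sup_section w a : A w -> K a -> f (w, a) <= sup [set f (w, a) | a in K].
Proof.
by move=> Aw Ka; apply: (ub_le_sup (has_sup_section Aw).2); exists a.
Qed.

Lemma sup_section_le w c : A w -> (forall a, K a -> f (w, a) <= c) ->
  sup [set f (w, a) | a in K] <= c.
Proof.
move=> Aw fc; apply: ge_sup; first exact: (has_sup_section Aw).1.
by move=> _ [a Ka <-]; exact: fc.
Qed.

(** The set where the supremum exceeds [c] is a countable union of projections of superlevel sets.
    These are compact by semicontinuity, and so are their projections. *)
Lemma measurable_sup_section :
  measurable_fun (A : set (borel V1)) (fun w => sup [set f (w, a) | a in K]).
Proof.
have hV (V : normedModType R) : hausdorff_space V by exact: norm_hausdorff.
have mA : measurable (A : set (borel V1)).
  by apply: closed_borel; apply: compact_closed.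
move=> _; apply: (measurability _ (RGenOInfty.measurableE R)) => // _ [_ [c ->] <-].
pose Q n := A `*` K `&` [set x | c + n.+1%:R^-1 <= f x].
rewrite (_ : _ `&` _ = \bigcup_n [set x.1 | x in Q n]); last first.
  apply/seteqP; split=> [w [Aw] /=|w [n _ [[v a] [[/= Av Ka] /= cf] <-]]].
    rewrite in_itv /= andbT => cw.
    have [_ [a Ka <-] ca] := sup_gt (has_sup_section Aw).1 cw.
    have d0 : 0 < f (w, a) - c by rewrite subr_gt0.
    exists (Num.bound (f (w, a) - c)^-1) => //; exists (w, a) => //; split=> //=.
    rewrite -lerBrDl invf_ple ?posrE//; apply: ltW.
    apply: lt_le_trans (archi_boundP _) _; first by rewrite invr_ge0 ltW.
    by rewrite ler_nat.
  split=> //=; rewrite in_itv /= andbT.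
  apply: lt_le_trans (le_sup_section Av Ka); apply: lt_le_trans cf.
  by rewrite ltrDl invr_gt0.
apply: bigcupT_measurable => n; apply: closed_borel; apply: compact_closed => //.
apply: continuous_compact; last first.
  by apply: compact_superlevel => //; exact: compact_setX.
by apply: continuous_subspaceT => x; exact: cvg_fst.
Qed.

End semicontinuity.

(** * Transfer of inequalities from the functional to its measure *)

Section functional_measure.
Context (R : realType) (V W : normedModType R) (L : (V -> R) -> R).
Context (mu : probability (borel V) R) (Z : V -> W).
Hypotheses (LD : forall f g : V -> R, continuous f -> continuous g ->
    L (fun x => f x + g x) = L f + L g)
  (LZ : forall (a : R) (f : V -> R), continuous f ->
    L (fun x => a * f x) = a * L f)
  (L1 : L (fun=> 1) = 1)
  (muL : forall (A : set V) (f : V -> R), continuous f ->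
    (forall x, 0 <= f x) -> (forall x, A x -> 1 <= f x) ->
    (mu A <= (L f)%:E)%E)
  (cZ : continuous Z).

Let mZB (B : set (borel W)) : measurable B ->
  measurable (Z @^-1` B : set (borel V)).
Proof.
move=> mB; rewrite -[X in measurable X]setTI.
exact: (@continuous_borel_measurable _ _ _ Z).
Qed.

(** The function [1 - g] is a continuous majorant of the indicator of the complement, so [muL]
    applied there gives the estimate opposite to [muL]. *)
Lemma functional_le_support (g : V -> R) : continuous g ->
  (forall x, 0 <= g x <= 1) -> ((L g)%:E <= mu [set x | (0 < g x)%R])%E.
Proof.
move=> cg g01; pose h x := 1 + (-1) * g x.
have cg1 : continuous (fun x => -1 * g x).
  by move=> x; apply: cvgM; [exact: cvg_cst|exact: cg].
have ch : continuous h by move=> x; apply: cvgD; [exact: cvg_cst|exact: cg1].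
have c1 : continuous (fun _ : V => 1 : R) by move=> x; exact: cvg_cst.
have Lh : L h = 1 - L g by rewrite LD// LZ// L1 mulN1r.
have mG : measurable ([set x | 0 < g x] : set (borel V)).
  by have /continuousP/(_ _ (@open_gt R 0)) := cg; exact: open_borel.
have : (mu (~` [set x | (0 < g x)%R]) <= (L h)%:E)%E.
  apply: muL => // x; first by rewrite /h; have := g01 x; lra.
  by move=> /= /negP; rewrite -leNgt /h; have := g01 x; lra.
rewrite probability_setC// Lh.
have fG : mu [set x | 0 < g x] \is a fin_num by exact: fin_num_measure.
by rewrite -(fineK fG) -[1%E]/(1%:E) -!EFinB !lee_fin; lra.
Qed.

(** Cutoffs give that the image of [mu] is at most [P] on closed sets, and regularity extends this
    to Borel sets. Two probabilities ordered in this way coincide, by taking complements. *)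
Lemma functional_marginal (P : probability (borel W) R) :
  (forall g : W -> R, continuous g -> (forall x, 0 <= g x <= 1) ->
    ((L (g \o Z))%:E <= P [set x | (0 < g x)%R])%E) ->
  forall B : set (borel W), measurable B -> mu (Z @^-1` B) = P B.
Proof.
move=> LP.
have [PZ PZE] := restricted_law_measure mu
  (@continuous_borel_measurable _ _ _ Z cZ) measurableT.
have PZB B : PZ B = mu (Z @^-1` B) by rewrite PZE setTI.
have le B : measurable (B : set (borel W)) -> (mu (Z @^-1` B) <= P B)%E.
  move=> mB; rewrite -PZB -[leLHS]mul1e.
  apply: le_measure_closed => // F cF; rewrite mul1e PZB.
  have [d [cd d0 dF]] := closed_zero_set cF.
  have Pfin : (P setT < +oo)%E by rewrite probability_setT ltry.
  have cvP := cvg_cutoff_gt0 cd d0 Pfin.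
  have -> : F = [set x | d x = 0] by apply/seteqP; split=> x /dF.
  rewrite -(cvg_lim _ cvP)//; apply: lime_ge; first by apply/cvg_ex; exists (P [set x | d x = 0]).
  apply: nearW => m; apply: le_trans (LP (cutoff d m) _ _).
  - apply: muL => [x|x|x /= dx]; rewrite /= ?cutoff_ge0 ?cutoff1//.
    by apply: continuous_comp; [exact: cZ|exact: continuous_cutoff].
  - exact: continuous_cutoff.
  - by move=> x; rewrite cutoff_ge0 cutoff_le1.
move=> B mB; apply/eqP; rewrite eq_le le//=.
have := le _ (measurableC mB); rewrite preimage_setC !probability_setC//; last exact: mZB.
have fB : P B \is a fin_num by exact: fin_num_measure.
have fZB : mu (Z @^-1` B) \is a fin_num by apply: fin_num_measure; exact: mZB.
by rewrite -(fineK fB) -(fineK fZB) -[1%E]/(1%:E) -!EFinB !lee_fin; lra.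
Qed.

(* [h] ranges over the continuous majorants of the indicator of [E]. *)
Lemma functional_closed_constraint (E : set V) (c : R) : 0 < c -> closed E ->
  (forall (l : W -> R) (h : V -> R), continuous l -> (forall w, 0 <= l w) ->
    continuous h -> (forall x, (x \in E)%:R <= h x) ->
    c * L (l \o Z) <= L (fun x => l (Z x) * h x)) ->
  forall B : set (borel W), measurable B ->
  (c%:E * mu (Z @^-1` B) <= mu (E `&` Z @^-1` B))%E.
Proof.
move=> c0 cE LE; have mE := closed_borel cE.
have mZ := @continuous_borel_measurable _ _ _ Z cZ.
have [PZ PZE] := restricted_law_measure mu mZ measurableT.
have [nu nuE] := restricted_law_measure mu mZ mE.
have PZB B : PZ B = mu (Z @^-1` B) by rewrite PZE setTI.
move=> B mB; rewrite -PZB -nuE; apply: le_measure_closed => // F cF.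
rewrite PZB; apply: (@le_trans _ _ (mu (E `&` Z @^-1` F))); last by rewrite -nuE.
have [dF [cdF dF0 dFE]] := closed_zero_set cF.
have [dE [cdE dE0 dEE]] := closed_zero_set cE.
(* The zero set of [d] is [E] intersected with the preimage of [F], and [cutoff d m] is the minimum
   of the two separate cutoffs, so it is positive wherever their product is. *)
pose d x := Num.max (dE x) (dF (Z x)).
have cdZ : continuous (dF \o Z).
  by move=> x; apply: continuous_comp; [exact: cZ|exact: cdF].
have cd : continuous d.
  by move=> x; apply: (@continuous_max R V dE (dF \o Z)); [exact: cdE|exact: cdZ].
have d0 x : 0 <= d x by rewrite le_max dE0.
have -> : E `&` Z @^-1` F = [set x | d x = 0].
  apply/seteqP; split=> x /=.
    by move=> [/dEE Ex /dFE Fx]; rewrite /d Ex Fx maxxx.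
  move=> dx0; have : dE x <= 0 /\ dF (Z x) <= 0.
    by apply/andP; rewrite -ge_max -/(d x) dx0.
  move=> [hE hF]; split.
    by apply/dEE/eqP; rewrite eq_le hE dE0.
  by apply/dFE/eqP; rewrite eq_le hF dF0.
have mufin : (mu setT < +oo)%E by rewrite probability_setT ltry.
have cvm := cvg_cutoff_gt0 cd d0 mufin.
rewrite -(cvg_lim _ cvm)//; apply: lime_ge; first by apply/cvg_ex; exists (mu [set x | d x = 0]).
apply: nearW => m.
have cZm : continuous (cutoff dF m \o Z).
  by move=> x; apply: continuous_comp; [exact: cZ|exact: continuous_cutoff].
have cEm := @continuous_cutoff _ _ _ cdE m.
(* From [mu] up to [L] by [muL], then the hypothesis with both test functions taken to be cutoffs,
   then back to [mu] by [functional_le_support]. *)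
apply: (@le_trans _ _ (c * L (cutoff dF m \o Z))%:E).
  rewrite EFinM; apply: lee_wpmul2l; first by rewrite lee_fin ltW.
  apply: muL => [//|x|x /= /dFE dx]; first exact: cutoff_ge0.
  by rewrite cutoff1.
apply: (@le_trans _ _ (L (fun x => cutoff dF m (Z x) * cutoff dE m x))%:E).
  rewrite lee_fin; apply: LE => //; first exact: continuous_cutoff.
    by move=> w; exact: cutoff_ge0.
  move=> x; case: (boolP (x \in E)) => [|_]; last exact: cutoff_ge0.
  by rewrite inE => /dEE dx; rewrite cutoff1.
apply: le_trans (functional_le_support _ _) _.
- by move=> x; apply: cvgM; [exact: cZm|exact: cEm].
- by move=> x; rewrite mulr_ge0 ?cutoff_ge0// mulr_ile1 ?cutoff_ge0 ?cutoff_le1.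
apply: le_measure; rewrite ?inE.
- have cp : continuous (fun x => cutoff dF m (Z x) * cutoff dE m x).
    by move=> x; apply: cvgM; [exact: cZm|exact: cEm].
  by have /continuousP/(_ _ (@open_gt R 0)) := cp; exact: open_borel.
- exact: measurable_cutoff_gt0.
move=> x /= h.
have hF : 0 < cutoff dF m (Z x).
  by rewrite lt_neqAle cutoff_ge0 andbT eq_sym; apply: contraTneq h => ->; rewrite mul0r ltxx.
have hE : 0 < cutoff dE m x.
  by rewrite lt_neqAle cutoff_ge0 andbT eq_sym; apply: contraTneq h => ->; rewrite mulr0 ltxx.
move: hE hF; rewrite !cutoff_gt0 /d => hE hF.
by rewrite maxEle; case: ifP.
Qed.

End functional_measure.

(** * Support, residuals and the integrand of the dual objective *)

Lemma closed_le_continuous (R : realType) (X : topologicalType) (f g : X -> R) :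
  continuous f -> continuous g -> closed [set x | f x <= g x].
Proof.
move=> cf cg; have cgf : continuous (fun x => g x - f x).
  by move=> x; apply: cvgB; [exact: cg|exact: cf].
have -> : [set x | f x <= g x] = (fun x => g x - f x) @^-1` [set y | 0 <= y].
  by apply/seteqP; split=> x /=; rewrite subr_ge0.
by apply: preimage_closed => [x _|]; [exact: cgf|exact: closed_ge].
Qed.

Section observations.
Context (R : realType) (T k : nat).

Definition rational_obs (i : 'cV[rat]_T * 'M[rat]_(T, k)) : obs R T k :=
  (map_mx ratr i.1, map_mx ratr i.2).

Lemma rational_obs_dense (x : obs R T k) (e : R) : 0 < e ->
  exists i, ball x e (rational_obs i).
Proof.
move=> e0.
have near_rat (r : R) : exists q : rat, `|r - ratr q| < e.
  have [|q] := @rat_in_itvoo R (r - e) (r + e); first by lra.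
  by rewrite in_itv /= => qr; exists q; rewrite ltr_norml; lra.
pose q r := sval (cid (near_rat r)).
have qP r : `|r - ratr (q r)| < e by rewrite /q; case: cid.
exists (\matrix_(i, j) q (x.1 i j), \matrix_(i, j) q (x.2 i j)).
by split; split=> // i j; rewrite !mxE; exact: qP.
Qed.

Lemma continuous_residual (b : 'cV[R]_k) (t : 'I_T) :
  continuous (fun w : obs R T k => residual b w t).
Proof.
have cfst : continuous (fun w : obs R T k => w.1) by move=> w; exact: cvg_fst.
have csnd : continuous (fun w : obs R T k => w.2) by move=> w; exact: cvg_snd.
have c1 : continuous (fun w : obs R T k => w.1 t 0).
  exact: (continuous_compf cfst (@coord_continuous _ _ _ t 0)).
have c2 j : continuous (fun w : obs R T k => w.2 t j * b j 0).
  move=> w; apply: cvgM; last exact: cvg_cst.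
  exact: (continuous_compf csnd (@coord_continuous _ _ _ t j)).
have c3 : continuous (fun w : obs R T k => \sum_j w.2 t j * b j 0).
  exact: continuous_sumf.
move=> w; rewrite /residual.
have -> : (fun w : obs R T k => w.1 t 0 - (w.2 *m b) t 0) =
    fun w => w.1 t 0 - \sum_j w.2 t j * b j 0.
  by apply/funext => v; rewrite mxE.
by apply: cvgB; [exact: c1|exact: c3].
Qed.

Context (Pobs : probability (borel (obs R T k)) R).

Lemma calW_full : Pobs (calW Pobs) = 1%E.
Proof. exact: law_support_full rational_obs_dense. Qed.

Lemma calW_nonempty : calW Pobs !=set0.
Proof.
apply/set0P/eqP => W0; have := calW_full; rewrite W0 measure0 => /eqP.
by rewrite eq_sym onee_eq0.
Qed.

Lemma measurable_calW : measurable (calW Pobs : set (borel (obs R T k))).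
Proof. by apply: closed_borel; exact: closed_law_support. Qed.

Lemma calX_calW (w : obs R T k) : calW Pobs w -> calX Pobs w.2.
Proof.
move=> Ww U oU Uw; apply: Ww => //=.
have csnd : continuous (fun w : obs R T k => w.2) by move=> v; exact: cvg_snd.
by have /continuousP := csnd; apply.
Qed.

Hypothesis cW : compact (calW Pobs).
Hypothesis T_gt0 : (0 < T)%N.
Context (b : 'cV[R]_k).

Let bounded_residuals : exists C, forall r, residuals Pobs b r -> `|r| <= C.
Proof.
have bt (t : 'I_T) : exists C, forall w, calW Pobs w -> `|residual b w t| <= C.
  apply: (@within_compact_bounded _ _ _ (fun w => residual b w t) cW).
  by apply: continuous_subspaceT; exact: continuous_residual.
have [C Ct] : {C : 'I_T -> R & forall t w, calW Pobs w -> `|residual b w t| <= C t}.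
  exact: (@choice _ _ (fun t C => forall w, calW Pobs w -> `|residual b w t| <= C)).
exists (\sum_t `|C t|) => _ [w [t [Ww ->]]].
apply: le_trans (Ct t w Ww) _; rewrite (bigD1 t)//=.
by apply: le_trans (ler_norm _) _; rewrite lerDl sumr_ge0.
Qed.

Lemma residual_K w t : calW Pobs w -> K Pobs b (residual b w t).
Proof.
move=> Ww; have [C CE] := bounded_residuals.
have rw : residuals Pobs b (residual b w t) by exists w, t.
rewrite /K /= in_itv /=; apply/andP; split.
  apply: ge_inf => //; exists (- C) => r /CE; rewrite ler_norml => /andP[]//.
apply: ub_le_sup => //; exists C => r /CE; rewrite ler_norml => /andP[]//.
Qed.

Lemma K_nonempty : K Pobs b !=set0.
Proof.
have [w Ww] := calW_nonempty.
by exists (residual b w (Ordinal T_gt0)); exact: residual_K.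
Qed.

Lemma compact_calW_K : compact (calW Pobs `*` K Pobs b).
Proof. by apply: compact_setX => //; exact: segment_compact. Qed.

Lemma within_multiplier (l : 'M[R]_(T, k) * R -> R) :
  {within calX Pobs `*` K Pobs b, continuous l} ->
  {within calW Pobs `*` K Pobs b, continuous (fun x : obs R T k * R => l (x.1.2, x.2))}.
Proof.
apply: (@within_continuous_comp _ _ _ _ _ (fun x : obs R T k * R => (x.1.2, x.2))).
  have c1 : continuous (fun x : obs R T k * R => x.1) by move=> y; exact: cvg_fst.
  have c3 : continuous (fun x : obs R T k * R => x.2) by move=> y; exact: cvg_snd.
  have c2 : continuous (fun w : obs R T k => w.2) by move=> y; exact: cvg_snd.
  exact: (continuous_pairf (continuous_compf c1 c2) c3).
by move=> [w a] /= [Ww Ka]; split=> //; exact: calX_calW.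
Qed.

Context (tau : R) (lambda : multipliers R T k).
Hypotheses (tau01 : 0 < tau < 1) (lambdaP : admissible Pobs b lambda).

(** Boundedness makes the real [sup] in [Psi] a true supremum and not the default value. The
    multipliers are pulled back to the compact set [calW Pobs] times [K Pobs b], and the factors
    multiplying them lie in $[-1,1]$. *)
Lemma Sfun_bounded : exists C, forall w a, calW Pobs w -> K Pobs b a ->
  `|Sfun tau b lambda w a| <= C.
Proof.
have bl (l : 'M[R]_(T, k) * R -> R) : {within calX Pobs `*` K Pobs b, continuous l} ->
    exists C, forall x, (calW Pobs `*` K Pobs b) x -> `|l (x.1.2, x.2)| <= C.
  by move=> /within_multiplier; exact: within_compact_bounded compact_calW_K.
have [C CP] : {C : 'I_T -> R & forall t x, (calW Pobs `*` K Pobs b) x ->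
    `|(lambda t).1 (x.1.2, x.2)| + `|(lambda t).2 (x.1.2, x.2)| <= C t}.
  apply: (@choice _ _ (fun t C => forall x, (calW Pobs `*` K Pobs b) x ->
    `|(lambda t).1 (x.1.2, x.2)| + `|(lambda t).2 (x.1.2, x.2)| <= C)) => t.
  have [[/bl[C1 h1] _] [/bl[C2 h2] _]] := lambdaP t.
  by exists (C1 + C2) => x Qx; apply: lerD; [exact: h1|exact: h2].
have /andP[tau0 tau1] := tau01.
exists (\sum_t C t) => w a Ww Ka; rewrite /Sfun.
apply: le_trans (ler_norm_sum _ _ _) _; apply: ler_sum => t _.
apply: le_trans (CP t (w, a) (conj Ww Ka)).
apply: le_trans (ler_normD _ _) _; rewrite !normrM; apply: lerD.
  rewrite ler_piMr// ler_norml; by case: (residual b w t <= a) => /=; lra.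
rewrite ler_piMr// ler_norml; by case: (residual b w t < a) => /=; lra.
Qed.

(** Since $\tau-1(r<a)=1(a\le r)-(1-\tau)$, the sum consists of nonnegative multipliers times
    indicators of closed sets, plus a continuous function. *)
Lemma Sfun_usc : usc_on (calW Pobs `*` K Pobs b)
  (fun x : obs R T k * R => Sfun tau b lambda x.1 x.2).
Proof.
set Q := _ `*` _.
have c1 : continuous (fun x : obs R T k * R => x.1) by move=> y; exact: cvg_fst.
have c2 : continuous (fun x : obs R T k * R => x.2) by move=> y; exact: cvg_snd.
have cr t : continuous (fun x : obs R T k * R => residual b x.1 t).
  exact: (continuous_compf c1 (@continuous_residual b t)).
pose E1 t := [set x : obs R T k * R | residual b x.1 t <= x.2].
pose E2 t := [set x : obs R T k * R | x.2 <= residual b x.1 t].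
have uS t : usc_on Q (fun x =>
    ((lambda t).1 (x.1.2, x.2) * (x \in E1 t)%:R +
     (lambda t).2 (x.1.2, x.2) * (x \in E2 t)%:R) +
    (- tau * (lambda t).1 (x.1.2, x.2) + - (1 - tau) * (lambda t).2 (x.1.2, x.2))).
  have [[cl1 l1] [cl2 l2]] := lambdaP t.
  have cl1' := within_multiplier cl1; have cl2' := within_multiplier cl2.
  apply: usc_onD; first apply: usc_onD.
  - apply: usc_on_restrict => //; first exact: closed_le_continuous.
    by move=> [w a] [/= Ww Ka]; apply: l1; split=> //; exact: calX_calW.
  - apply: usc_on_restrict => //; first exact: closed_le_continuous.
    by move=> [w a] [/= Ww Ka]; apply: l2; split=> //; exact: calX_calW.
  - apply: usc_on_continuous => x; apply: cvgD.
      by apply: cvgM; [exact: cvg_cst|exact: cl1'].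
    by apply: cvgM; [exact: cvg_cst|exact: cl2'].
rewrite (_ : (fun x => _) = fun x => \sum_(t < T)
    (((lambda t).1 (x.1.2, x.2) * (x \in E1 t)%:R +
     (lambda t).2 (x.1.2, x.2) * (x \in E2 t)%:R) +
    (- tau * (lambda t).1 (x.1.2, x.2) + - (1 - tau) * (lambda t).2 (x.1.2, x.2)))).
  exact: usc_on_sum.
apply/funext => x; apply: eq_bigr => t _.
have -> : (x \in E1 t) = (residual b x.1 t <= x.2) by apply/idP/idP; rewrite inE.
have -> : (x \in E2 t) = (x.2 <= residual b x.1 t) by apply/idP/idP; rewrite inE.
rewrite ltNge; case: (x.2 <= _); case: (_ <= x.2); rewrite /= ?mulr0n ?mulr1n; ring.
Qed.

Lemma Sfun_le_sup w a : calW Pobs w -> K Pobs b a ->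
  Sfun tau b lambda w a <= sup [set Sfun tau b lambda w a | a in K Pobs b].
Proof.
have [C SC] := Sfun_bounded.
exact: (@le_sup_section _ _ _ _ _ (fun x => Sfun tau b lambda x.1 x.2) K_nonempty C).
Qed.

Lemma sup_Sfun_le w c : calW Pobs w ->
  (forall a, K Pobs b a -> Sfun tau b lambda w a <= c) ->
  sup [set Sfun tau b lambda w a | a in K Pobs b] <= c.
Proof.
have [C SC] := Sfun_bounded.
exact: (@sup_section_le _ _ _ _ _ (fun x => Sfun tau b lambda x.1 x.2) K_nonempty C).
Qed.

Lemma sup_Sfun_integrable : Pobs.-integrable (calW Pobs)
  (EFin \o (fun w => sup [set Sfun tau b lambda w a | a in K Pobs b])).
Proof.
have [C SC] := Sfun_bounded; have [a0 Ka0] := K_nonempty.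
apply: measurable_bounded_integrable.
- exact: measurable_calW.
- by rewrite -ge0_fin_numE// fin_num_measure//; exact: measurable_calW.
- apply: (@measurable_sup_section _ _ _ (calW Pobs) (K Pobs b)
    (fun x => Sfun tau b lambda x.1 x.2)) => //.
  + exact: segment_compact.
  + exact: K_nonempty.
  + exact: Sfun_usc.
  + exact: SC.
- exists C; split; first exact: num_real.
  move=> x Cx w /= Ww; apply: le_trans (ltW Cx); rewrite ler_norml.
  have hlow := Sfun_le_sup Ww Ka0; have /andP[h _] : - C <= Sfun tau b lambda w a0 <= C.
    by rewrite -ler_norml; exact: SC.
  rewrite (le_trans h hlow)/=; apply: sup_Sfun_le => // a Ka.
  by apply: le_trans (ler_norm _) (SC _ _ _ _).
Qed.

End observations.

(** * Sufficiency: a coupling from nonnegativity of the dual objective *)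

Lemma continuous_matrix (R : realType) (X : topologicalType) (m n : nat)
    (F : X -> 'M[R]_(m, n)) : (forall i j, continuous (fun x => F x i j)) ->
  continuous F.
Proof.
move=> cF x; apply/cvg_ballP => e e0.
have : \forall y \near x, forall i j, ball (F x i j) e (F y i j).
  apply: filter_forall => i; apply: filter_forall => j.
  by have /cvg_ballP := cF i j x; apply.
by apply: filterS => y h; split.
Qed.

Lemma probability_pushforward d d' (Omega : measurableType d)
    (S : measurableType d') (R : realType) (P : probability Omega R)
    (Z : Omega -> S) : measurable_fun setT Z ->
  exists PZ : probability S R, forall B, PZ B = P (Z @^-1` B).
Proof.
move=> mZ.
pose X : {mfun Omega >-> S} := HB.pack Z (isMeasurableFun.Build _ _ _ _ Z mZ).
by exists (distribution P X).
Qed.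

Section sufficiency.
Context (R : realType) (T k : nat) (tau : R) (b : 'cV[R]_k).
Context (Pobs : probability (borel (obs R T k)) R).
Hypotheses (T_gt0 : (0 < T)%N) (tau0 : 0 < tau) (tau1 : tau < 1)
  (cW : compact (calW Pobs)).

Let Omega := (obs R T k * R)%type.
Let W := calW Pobs.
Let Kb := K Pobs b.

(** Multipliers regular on the whole space, because [L] acts on functions continuous everywhere. *)
Definition global_multiplier (lambda : multipliers R T k) :=
  forall t, (continuous (lambda t).1 /\ forall x, 0 <= (lambda t).1 x) /\
            (continuous (lambda t).2 /\ forall x, 0 <= (lambda t).2 x).

Lemma global_admissible lambda : global_multiplier lambda ->
  admissible Pobs b lambda.
Proof.
move=> gl t; have [[c1 l1] [c2 l2]] := gl t.
by split; split=> //; exact: continuous_subspaceT.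
Qed.

(** Weak duality: under any feasible law of $(W,A)$ carried by $\mathcal W\times K_b$, the [Sfun]
    term has nonnegative mean, so the mean of [f] is at most [c]. Using a majorant [G] instead of
    the maximum over [a] makes bounds easy to add. *)
Definition dual_bound (f : Omega -> R) (c : R) : Prop :=
  exists2 lambda, global_multiplier lambda & exists2 G : obs R T k -> R,
    Pobs.-integrable setT (EFin \o G) &
    (forall w a, W w -> Kb a -> f (w, a) + Sfun tau b lambda w a <= G w) /\
    (\int[Pobs]_w (G w)%:E = c%:E)%E.

Let lambda0 : multipliers R T k := fun=> (fun=> 0, fun=> 0).

Let global_lambda0 : global_multiplier lambda0.
Proof. by move=> t; split; split=> // x; exact: cvg_cst. Qed.

Let Sfun_lambda0 w a : Sfun tau b lambda0 w a = 0.
Proof. by rewrite /Sfun big1// => t _; rewrite !mul0r addr0. Qed.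

Let dual_bound_cst (f : Omega -> R) (c : R) :
  (forall w a, W w -> Kb a -> f (w, a) <= c) -> dual_bound f c.
Proof.
move=> fc; exists lambda0 => //; exists (fun=> c).
  exact: (finite_measure_integrable_cst _ c measurableT).
split=> [w a Ww Ka|]; first by rewrite Sfun_lambda0 addr0; exact: fc.
by rewrite (integral_cst _ measurableT) [X in (_ * X)%E](probability_setT Pobs) mule1.
Qed.

Let dual_boundD f g c d : dual_bound f c -> dual_bound g d ->
  dual_bound (fun x => f x + g x) (c + d).
Proof.
move=> [l gl [G iG [fG EG]]] [l' gl' [G' iG' [gG' EG']]].
exists (fun t => (fun x => (l t).1 x + (l' t).1 x, fun x => (l t).2 x + (l' t).2 x)).
  move=> t; have [[c1 h1] [c2 h2]] := gl t; have [[c1' h1'] [c2' h2']] := gl' t.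
  split; split=> [|x]; [exact: continuous_addf c1 c1'|exact: addr_ge0 (h1 x) (h1' x)
    |exact: continuous_addf c2 c2'|exact: addr_ge0 (h2 x) (h2' x)].
exists (fun w => G w + G' w).
  have -> : EFin \o (fun w => G w + G' w) = ((EFin \o G) \+ (EFin \o G'))%E.
    by apply/funext => w.
  exact: integrableD.
split=> [w a Ww Ka|].
  have -> : Sfun tau b (fun t => (fun x => (l t).1 x + (l' t).1 x,
      fun x => (l t).2 x + (l' t).2 x)) w a =
      Sfun tau b l w a + Sfun tau b l' w a.
    by rewrite /Sfun -big_split /=; apply: eq_bigr => t _; ring.
  by rewrite addrACA lerD ?fG ?gG'.
under eq_integral => w _ do rewrite EFinD.
by rewrite integralD//= EG EG'.
Qed.

Let dual_boundZ a f c : 0 < a -> dual_bound f c ->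
  dual_bound (fun x => a * f x) (a * c).
Proof.
move=> a0 [l gl [G iG [fG EG]]].
exists (fun t => (fun x => a * (l t).1 x, fun x => a * (l t).2 x)).
  move=> t; have [[c1 h1] [c2 h2]] := gl t.
  have ca := @continuous_cstf R ('M[R]_(T, k) * R)%type a.
  split; split=> [|x]; [exact: continuous_mulf ca c1|exact: mulr_ge0 (ltW a0) (h1 x)
    |exact: continuous_mulf ca c2|exact: mulr_ge0 (ltW a0) (h2 x)].
exists (fun w => a * G w).
  have -> : EFin \o (fun w => a * G w) = (fun w => a%:E * (EFin \o G) w)%E.
    by apply/funext => w.
  exact: integrableZl.
split=> [w r Ww Kr|].
  have -> : Sfun tau b (fun t => (fun x => a * (l t).1 x,
      fun x => a * (l t).2 x)) w r = a * Sfun tau b l w r.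
    by rewrite /Sfun mulr_sumr; apply: eq_bigr => t _ /=; ring.
  by rewrite -mulrDr ler_pM2l// fG.
under eq_integral => w _ do rewrite EFinM.
by rewrite integralZl//= EG.
Qed.

Hypothesis Psi_ge0 : forall lambda, admissible Pobs b lambda ->
  (0 <= Psi Pobs tau b lambda)%E.

Let tau01 : 0 < tau < 1. Proof. by rewrite tau0. Qed.

(** This is the consistency condition of Hahn-Banach and the point where [Psi_ge0] enters: a
    majorant [G] of [Sfun] also majorizes its supremum, so [c] is at least [Psi] of the
    multiplier. *)
Let dual_bound0 c : dual_bound (fun=> 0) c -> 0 <= c.
Proof.
move=> [l gl [G iG [fG EG]]]; have al := global_admissible gl.
have mW := measurable_calW Pobs.
rewrite -lee_fin -EG; apply: le_trans (Psi_ge0 al) _.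
have W0 : Pobs (~` W) = 0%E.
  by rewrite probability_setC// calW_full subee.
rewrite [leRHS](negligible_integral (measurableC mW) measurableT iG W0).
rewrite setTD setCK.
apply: le_integral => //; first exact: sup_Sfun_integrable.
  exact: integrableS iG.
move=> w; rewrite inE => Ww; rewrite lee_fin; apply: sup_Sfun_le => // a Ka.
by rewrite -[leLHS]add0r; exact: fG.
Qed.

Let multiplier_minus (t : 'I_T) l : multipliers R T k :=
  fun s => if s == t then (l, fun=> 0) else (fun=> 0, fun=> 0).

Let multiplier_plus (t : 'I_T) l : multipliers R T k :=
  fun s => if s == t then (fun=> 0, l) else (fun=> 0, fun=> 0).

Let global_minus t (l : 'M[R]_(T, k) * R -> R) : continuous l -> (forall x, 0 <= l x) ->
  global_multiplier (multiplier_minus t l).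
Proof.
move=> cl l0 s; rewrite /multiplier_minus; case: eqP => _ /=.
  by split; split=> // x; exact: cvg_cst.
exact: global_lambda0.
Qed.

Let global_plus t (l : 'M[R]_(T, k) * R -> R) : continuous l -> (forall x, 0 <= l x) ->
  global_multiplier (multiplier_plus t l).
Proof.
move=> cl l0 s; rewrite /multiplier_plus; case: eqP => _ /=.
  by split; split=> // x; exact: cvg_cst.
exact: global_lambda0.
Qed.

Let Sfun_minus t l w a : Sfun tau b (multiplier_minus t l) w a =
  l (w.2, a) * ((residual b w t <= a)%R%:R - tau).
Proof.
rewrite /Sfun (bigD1 t)//= big1 => [|s /negPf st]; rewrite /multiplier_minus.
  by rewrite eqxx /= mul0r !addr0.
by rewrite st /= !mul0r addr0.
Qed.

Let Sfun_plus t l w a : Sfun tau b (multiplier_plus t l) w a =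
  l (w.2, a) * (tau - (residual b w t < a)%R%:R).
Proof.
rewrite /Sfun (bigD1 t)//= big1 => [|s /negPf st]; rewrite /multiplier_plus.
  by rewrite eqxx /= mul0r add0r addr0.
by rewrite st /= !mul0r addr0.
Qed.

Let below (t : 'I_T) := [set x : Omega | residual b x.1 t <= x.2].
Let above (t : 'I_T) := [set x : Omega | x.2 <= residual b x.1 t].
Let XA (x : Omega) : 'M[R]_(T, k) * R := (x.1.2, x.2).

Let cfst : continuous (fst : Omega -> obs R T k).
Proof. by move=> x; exact: cvg_fst. Qed.
Let csnd : continuous (snd : Omega -> R).
Proof. by move=> x; exact: cvg_snd. Qed.
Let csnd_obs : continuous (snd : obs R T k -> 'M[R]_(T, k)).
Proof. by move=> x; exact: cvg_snd. Qed.
Let cXA : continuous XA.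
Proof. exact: (continuous_pairf (continuous_compf cfst csnd_obs) csnd). Qed.
Let cresidual t : continuous (fun x : Omega => residual b x.1 t).
Proof. exact: (continuous_compf cfst (@continuous_residual R T k b t)). Qed.

Let closed_below t : closed (below t).
Proof. exact: closed_le_continuous. Qed.

Let closed_above t : closed (above t).
Proof. exact: closed_le_continuous. Qed.

(** Each property of [mu] comes from one family of bounds on [L]: zero multipliers with constant [G]
    for positivity and mass, zero multipliers with an indicator [G] for the marginal, one multiplier
    with [G = 0] for a constraint. *)
Lemma coupling_exists : exists mu : probability (borel Omega) R,
  [/\ forall C : set (borel (obs R T k)), measurable C -> mu (fst @^-1` C) = Pobs C,
      forall t (B : set (borel ('M[R]_(T, k) * R)%type)), measurable B ->
        (tau%:E * mu (XA @^-1` B) <= mu (below t `&` XA @^-1` B))%E &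
      forall t (B : set (borel ('M[R]_(T, k) * R)%type)), measurable B ->
        ((1 - tau)%:E * mu (XA @^-1` B) <= mu (above t `&` XA @^-1` B))%E].
Proof.
have cQ : compact (W `*` Kb) by exact: compact_calW_K.
(* [R^o] is [R] as a module over itself, which makes the functions a module. *)
pose V : lmodType R := Omega -> R^o.
pose D : set V := [set f | continuous (f : Omega -> R)].
have DD (f g : V) : D f -> D g -> D (f + g).
  by move=> cf cg x; apply: cvgD; [exact: cf|exact: cg].
have DZ a (f : V) : D f -> D (a *: f).
  by move=> cf x; apply: cvgM; [exact: cvg_cst|exact: cf].
have [||||L [LD LZ LB]] := @hahn_banach_bounds R V D DD DZ dual_bound.
- by move=> f g c d _ _; exact: dual_boundD.
- by move=> a f c _; exact: dual_boundZ.
- move=> f cf; have [C fC] := within_compact_bounded cQ (continuous_subspaceT cf).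
  exists C; apply: dual_bound_cst => w a Ww Ka.
  by apply: le_trans (ler_norm _) _; exact: (fC (w, a)).
- exact: dual_bound0.
have LN (f : Omega -> R) : continuous f -> L (fun x => - f x) = - L f.
  move=> cf; rewrite -mulN1r -LZ//; congr L.
  by apply/funext => x; exact: esym (mulN1r (f x)).
have c1 : continuous (fun _ : Omega => 1 : R) by move=> x; exact: cvg_cst.
have L_ge0 (f : Omega -> R) : continuous f ->
    (forall x, (W `*` Kb) x -> 0 <= f x) -> 0 <= L f.
  move=> cf f0; rewrite -oppr_le0 -LN//; apply: LB.
    by move=> x; apply: cvgN; exact: cf.
  by apply: dual_bound_cst => w a Ww Ka; rewrite oppr_le0; exact: (f0 (w, a)).
have L1 : L (fun=> 1) = 1.
  apply/eqP; rewrite eq_le; apply/andP; split.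
    by apply: LB => //; exact: dual_bound_cst.
  rewrite -lerN2 -LN//; apply: LB; first by move=> x; exact: cvg_cst.
  exact: dual_bound_cst.
have [mu muL] := riesz_probability cQ LD LZ L_ge0 L1.
exists mu; split.
- apply: (functional_marginal muL cfst) => g cg g01.
  have mG : measurable ([set x | 0 < g x] : set (borel (obs R T k))).
    by have /continuousP/(_ _ (@open_gt R 0)) := cg; exact: open_borel.
  have fG : Pobs [set x | 0 < g x] \is a fin_num by exact: fin_num_measure.
  rewrite -(fineK fG) lee_fin; apply: LB; first exact: (continuous_compf cfst cg).
  (* As [g] takes values in $[0,1]$, it is below the indicator of its positivity set. *)
  exists lambda0 => //; exists (\1_[set x | 0 < g x]).
    exact: (integrable_indic _ mG).
  split=> [w a Ww Ka|]; last by rewrite integral_indic// setIT fineK.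
  rewrite Sfun_lambda0 addr0 indicE /=; case: (boolP (w \in _)) => [_|].
    by have /andP[] := g01 w.
  by rewrite notin_setE /= => /negP; rewrite -leNgt.
- move=> t; apply: (functional_closed_constraint LD LZ L1 muL cXA) => //.
  move=> l h cl l0 ch hE.
  have clZ := continuous_compf cXA cl.
  have clh : continuous (fun x => l (XA x) * h x).
    exact: (continuous_mulf clZ ch).
  rewrite -LZ//.
  rewrite -subr_le0 -LN// -LD; last 2 first.
  + exact: (continuous_mulf (@continuous_cstf _ _ _) clZ).
  + exact: continuous_oppf.
  apply: LB.
    apply: continuous_subf clh.
    exact: (continuous_mulf (@continuous_cstf _ _ _) clZ).
  (* Adding [Sfun] cancels the [tau] terms and leaves $l\,(1(r\le a)-h)$, which is nonpositive since
     [h] majorizes the indicator. *)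
  exists (multiplier_minus t l); first exact: global_minus.
  exists (fun=> 0); first exact: (finite_measure_integrable_cst _ 0 measurableT).
  split=> [w a Ww Ka|]; last by rewrite integral0.
  rewrite Sfun_minus; have := hE (w, a).
  have -> : ((w, a) \in below t) = (residual b w t <= a) by apply/idP/idP; rewrite inE.
  move=> hwa; have := ler_wpM2l (l0 (w.2, a)) hwa.
  suff : l (w.2, a) * (residual b w t <= a)%R%:R <= l (w.2, a) * h (w, a) ->
    tau * l (w.2, a) - l (w.2, a) * h (w, a) +
    l (w.2, a) * ((residual b w t <= a)%R%:R - tau) <= 0 by [].
  by lra.
- move=> t; apply: (functional_closed_constraint LD LZ L1 muL cXA) => //.
    by rewrite subr_gt0.
  move=> l h cl l0 ch hE.
  have clZ := continuous_compf cXA cl.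
  have clh : continuous (fun x => l (XA x) * h x).
    exact: (continuous_mulf clZ ch).
  rewrite -LZ//.
  rewrite -subr_le0 -LN// -LD; last 2 first.
  + exact: (continuous_mulf (@continuous_cstf _ _ _) clZ).
  + exact: continuous_oppf.
  apply: LB.
    apply: continuous_subf clh.
    exact: (continuous_mulf (@continuous_cstf _ _ _) clZ).
  (* Here the sum is $l\,(1(a\le r)-h)$, because $(1-\tau)+\tau-1(r<a)=1(a\le r)$. *)
  exists (multiplier_plus t l); first exact: global_plus.
  exists (fun=> 0); first exact: (finite_measure_integrable_cst _ 0 measurableT).
  split=> [w a Ww Ka|]; last by rewrite integral0.
  rewrite Sfun_plus; have := hE (w, a).
  have -> : ((w, a) \in above t) = (a <= residual b w t) by apply/idP/idP; rewrite inE.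
  rewrite ltNge => hwa; have := ler_wpM2l (l0 (w.2, a)) hwa.
  suff : l (w.2, a) * (a <= residual b w t)%R%:R <= l (w.2, a) * h (w, a) ->
    (1 - tau) * l (w.2, a) - l (w.2, a) * h (w, a) +
    l (w.2, a) * (tau - (~~ (a <= residual b w t))%R%:R) <= 0 by [].
  by case: (a <= _) => /=; lra.
Qed.

End sufficiency.

(** * The conditional constraints in integrated form *)

(** The hypothesis compares [c] times the law of [Z] with the law of [Z] restricted to [E].
    Integrating [h] against both and pulling back along [Z] gives the claim; boundedness of [h]
    makes the difference of integrals meaningful. *)
Lemma cond_prob_integral_ge0 d d' (Omega : measurableType d)
    (S : measurableType d') (R : realType) (P : probability Omega R)
    (Z : Omega -> S) (E : set Omega) (c : R) (h : S -> R) (C : R) :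
  measurable_fun setT Z -> measurable E -> 0 <= c ->
  (forall B, measurable B -> (c%:E * P (Z @^-1` B) <= P (E `&` Z @^-1` B))%E) ->
  measurable_fun setT h -> (forall s, 0 <= h s <= C) ->
  P.-integrable setT (fun w => (h (Z w) * (\1_E w - c))%:E) /\
  (0 <= \int[P]_w (h (Z w) * (\1_E w - c))%:E)%E.
Proof.
move=> mZ mE c0 cP mh hC.
have h0 s : 0 <= h s by have /andP[] := hC s.
have mhZ : measurable_fun setT (h \o Z) by exact: measurableT_comp.
have ihZ : P.-integrable setT (fun w => (h (Z w))%:E).
  apply: (measurable_bounded_integrable measurableT _ mhZ).
    by rewrite -ge0_fin_numE// fin_num_measure.
  exists C; split; first exact: num_real.
  move=> x Cx w _ /=; rewrite ger0_norm//; apply: le_trans (ltW Cx).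
  by have /andP[] := hC (Z w).
have iE : P.-integrable setT (fun w => (h (Z w) * \1_E w)%:E).
  apply: (@le_integrable _ _ _ _ _ _ _ (fun w => (h (Z w))%:E)) => //.
    apply/measurable_EFinP; apply: measurable_funM => //.
  move=> w _ /=; rewrite lee_fin !ger0_norm// ?mulr_ge0// indicE.
  by case: (w \in E); rewrite ?mulr1 ?mulr0.
have [PZ PZE] := restricted_law_measure P mZ measurableT.
have [nu nuE] := restricted_law_measure P mZ mE.
pose k := NngNum c0.
have h0E s : (0 <= (h s)%:E)%E by rewrite lee_fin.
have mhE : measurable_fun setT (EFin \o h) by exact/measurable_EFinP.
have le1 : (\int[mscale k PZ]_(s in setT) (EFin \o h) s <=
    \int[nu]_(s in setT) (EFin \o h) s)%E.
  apply: ge0_le_measure_integral => //= B mB.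
  have : (c%:E * PZ B <= nu B)%E by rewrite PZE setTI nuE; exact: cP.
  by [].
have PZh : (\int[PZ]_(s in setT) (EFin \o h) s = \int[P]_w (h (Z w))%:E)%E.
  transitivity (\int[pushforward P Z]_(s in setT) (EFin \o h) s)%E.
    apply: eq_measure_integral => A mA _; apply: esym; rewrite /pushforward /=.
    by have := PZE A; rewrite setTI.
  by rewrite ge0_integral_pushforward// => s _; exact: h0E.
have nuh : (\int[nu]_(s in setT) (EFin \o h) s =
    \int[P]_w (h (Z w) * \1_E w)%:E)%E.
  transitivity (\int[pushforward (mrestr P mE) Z]_(s in setT) (EFin \o h) s)%E.
    apply: eq_measure_integral => A mA _; apply: esym.
    have e : nu A = mrestr P mE (Z @^-1` A) by rewrite nuE /mrestr setIC.
    exact: esym e.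
  rewrite ge0_integral_pushforward//; last by move=> s _; exact: h0E.
  rewrite preimage_setT.
  have mhZE : measurable_fun setT ((EFin \o h) \o Z) by exact/measurable_EFinP.
  have CE0 : mrestr P mE (~` E) = 0%E by rewrite /mrestr setICl measure0.
  rewrite (ge0_negligible_integral (measurableC mE) measurableT mhZE (fun w _ => h0E (Z w)) CE0).
  rewrite setTD setCK.
  transitivity (\int[P]_(w in E) ((EFin \o h) \o Z) w)%E.
    apply: eq_measure_integral => A mA AE.
    have e : mrestr P mE A = P A by rewrite /mrestr setIidl.
    by first [exact: e|exact: esym e].
  rewrite integral_mkcond; apply: eq_integral => w _.
  by rewrite /patch indicE; case: (w \in E); rewrite ?mulr1 ?mulr0.
have split_h : (fun w => (h (Z w) * (\1_E w - c))%:E) =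
    ((fun w => (h (Z w) * \1_E w)%:E) \- (fun w => c%:E * (h (Z w))%:E))%E.
  by apply/funext => w; rewrite mulrBr EFinB EFinM [h _ * c]mulrC EFinM.
have icZ : P.-integrable setT (fun w => c%:E * (h (Z w))%:E)%E.
  exact: integrableZl.
split; first by rewrite split_h; exact: integrableB.
have fE : (\int[P]_w (h (Z w) * \1_E w)%:E)%E \is a fin_num.
  exact: integrable_fin_num.
rewrite split_h integralB//= integralZl// subre_ge0// -nuh -PZh.
by move: le1; rewrite ge0_integral_mscale// => s _; exact: h0E.
Qed.

(** * The structural law built from a coupling *)

Section structural_law.
Context (R : realType) (T k : nat) (tau : R) (b : 'cV[R]_k).
Context (Pobs : probability (borel (obs R T k)) R).

Let Omega := (obs R T k * R)%type.
Let XA (x : Omega) : 'M[R]_(T, k) * R := (x.1.2, x.2).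

Definition struct_of (x : Omega) : struct R T k :=
  (x.1.1, x.1.2, x.2, x.1.1 - x.1.2 *m b - const_mx x.2).

Lemma sU_struct_of x t : sU (struct_of x) t 0 = residual b x.1 t - x.2.
Proof. by rewrite /sU /struct_of /residual /= !mxE. Qed.

Lemma continuous_sA : continuous (@sA R T k).
Proof. by apply: continuous_compf => x; [exact: cvg_fst|exact: cvg_snd]. Qed.

Lemma continuous_sU t : continuous (fun s : struct R T k => sU s t 0).
Proof.
apply: (@continuous_compf _ _ _ snd (fun M : 'cV[R]_T => M t 0)).
  by move=> x; exact: cvg_snd.
exact: coord_continuous.
Qed.

Lemma continuous_sW : continuous (@sW R T k : struct R T k -> obs R T k).
Proof.
have c1 : continuous (fun s : struct R T k => s.1.1).
  by apply: continuous_compf => x; exact: cvg_fst.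
have c2 : continuous (fun s : struct R T k => s.1.1.1).
  by apply: (continuous_compf c1) => x; exact: cvg_fst.
have c3 : continuous (fun s : struct R T k => s.1.1.2).
  by apply: (continuous_compf c1) => x; exact: cvg_snd.
exact: continuous_pairf.
Qed.

Lemma continuous_sXA :
  continuous (@sXA R T k : struct R T k -> 'M[R]_(T, k) * R).
Proof.
apply: continuous_pairf; last exact: continuous_sA.
apply: (continuous_compf continuous_sW (g := snd)) => x; exact: cvg_snd.
Qed.

Lemma continuous_struct_of : continuous struct_of.
Proof.
have cf : continuous (fst : Omega -> obs R T k) by move=> x; exact: cvg_fst.
have cs : continuous (snd : Omega -> R) by move=> x; exact: cvg_snd.
have c1 : continuous (fun x : Omega => x.1.1).
  by apply: (continuous_compf cf) => x; exact: cvg_fst.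
have c2 : continuous (fun x : Omega => x.1.2).
  by apply: (continuous_compf cf) => x; exact: cvg_snd.
apply: continuous_pairf; first by do 2 apply: continuous_pairf => //.
apply: continuous_matrix => i j; rewrite ord1.
have -> : (fun x : Omega => (x.1.1 - x.1.2 *m b - const_mx x.2) i 0) =
    fun x => residual b x.1 i - x.2.
  by apply/funext => x; rewrite -sU_struct_of.
apply: continuous_subf => //.
exact: (continuous_compf cf (@continuous_residual R T k b i)).
Qed.

Lemma measurable_sU_le0 t :
  measurable ([set s | sU s t 0 <= 0] : set (borel (struct R T k))).
Proof.
apply: closed_borel; apply: closed_le_continuous; first exact: continuous_sU.
exact: continuous_cstf.
Qed.

Lemma measurable_sU_lt0 t :
  measurable ([set s | sU s t 0 < 0] : set (borel (struct R T k))).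
Proof.
have -> : [set s : struct R T k | sU s t 0 < 0] = ~` [set s | 0 <= sU s t 0].
  by apply/seteqP; split=> s /=; rewrite ltNge => /negP.
apply: measurableC; apply: closed_borel; apply: closed_le_continuous.
  exact: continuous_cstf.
exact: continuous_sU.
Qed.

(** The law is the image of [mu] under [struct_of], where the model equation holds identically. The
    events $U_t\le0$ and $U_t\ge0$ pull back to $R_t(b)\le A$ and $A\le R_t(b)$. *)
Lemma identified_of_coupling (calB : set 'cV[R]_k)
    (mu : probability (borel Omega) R) : calB b ->
  (forall C : set (borel (obs R T k)), measurable C -> mu (fst @^-1` C) = Pobs C) ->
  (forall t (B : set (borel ('M[R]_(T, k) * R)%type)), measurable B ->
    (tau%:E * mu (XA @^-1` B) <=
     mu ([set x : Omega | (residual b x.1 t <= x.2)%R] `&` XA @^-1` B))%E) ->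
  (forall t (B : set (borel ('M[R]_(T, k) * R)%type)), measurable B ->
    ((1 - tau)%:E * mu (XA @^-1` B) <=
     mu ([set x : Omega | (x.2 <= residual b x.1 t)%R] `&` XA @^-1` B))%E) ->
  identified_set tau calB Pobs b.
Proof.
move=> calBb muC mu_below mu_above; split=> //.
have [Ps PsE] := probability_pushforward mu
  (@continuous_borel_measurable _ _ _ struct_of continuous_struct_of).
have msXA := @continuous_borel_measurable _ _ _ _ continuous_sXA.
exists Ps; split.
- move=> C mC; rewrite /pushforward PsE -muC//; congr (mu _).
  by apply/seteqP; split=> -[[y x] a].
- move=> t; pose f (s : struct R T k) := (sX s *m b) t 0 + sA s + sU s t 0.
  pose g (s : struct R T k) := sY s t 0 - (sX s *m b) t 0.
  have cg : continuous g.
    exact: (continuous_compf continuous_sW (@continuous_residual R T k b t)).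
  have csum : continuous (fun s : struct R T k => sA s + sU s t 0).
    by apply: continuous_addf; [exact: continuous_sA|exact: continuous_sU].
  pose N := ~` ([set s | g s <= sA s + sU s t 0] `&`
    [set s | sA s + sU s t 0 <= g s]).
  exists N; split.
  + apply: measurableC; apply: measurableI; apply: closed_borel;
      exact: closed_le_continuous.
  + rewrite PsE [X in mu X](_ : _ = set0) ?measure0//.
    apply/seteqP; split=> // x; apply.
    have e : residual b x.1 t = sA (struct_of x) + sU (struct_of x) t 0.
      by rewrite sU_struct_of /sA /= subrKC.
    by split; rewrite /mkset -[g _]/(residual b x.1 t) e.
  + move=> s /= ns [h1 h2]; apply: ns.
    have : g s = sA s + sU s t 0 by apply/eqP; rewrite eq_le h1 h2.
    by rewrite /g => h; rewrite -addrA -h subrKC.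
- move=> t; apply/(cond_prob_geP Ps msXA (measurable_sU_le0 t)) => B mB.
  rewrite !PsE; apply: le_trans (mu_below t B mB) _.
  rewrite [X in (mu X <= _)%E](_ : _ = struct_of @^-1`
    ([set s | sU s t 0 <= 0] `&` @sXA R T k @^-1` B))//.
  by apply/seteqP; split=> x /=; rewrite sU_struct_of subr_le0.
- move=> t; apply/(cond_prob_leP _ _ msXA (measurable_sU_lt0 t)).
  apply/(cond_prob_geP Ps msXA (measurableC (measurable_sU_lt0 t))) => B mB.
  rewrite !PsE; apply: le_trans (mu_above t B mB) _.
  rewrite [X in (mu X <= _)%E](_ : _ = struct_of @^-1`
    (~` [set s | sU s t 0 < 0] `&` @sXA R T k @^-1` B))//.
  apply/seteqP; split=> x /= [h xB]; split=> //.
    by apply/negP; rewrite sU_struct_of -leNgt subr_ge0.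
  by move/negP: h; rewrite sU_struct_of -leNgt subr_ge0.
Qed.

End structural_law.

(** * Necessity: a structural law makes the dual objective nonnegative *)

Lemma integral_sum_ge0 d (Omega : measurableType d) (R : realType)
    (P : {measure set Omega -> \bar R}) n (f : 'I_n -> Omega -> R) :
  (forall i, P.-integrable setT (EFin \o f i) /\
    (0 <= \int[P]_w (f i w)%:E)%E) ->
  P.-integrable setT (EFin \o (fun w => \sum_(i < n) f i w)) /\
  (0 <= \int[P]_w (\sum_(i < n) f i w)%:E)%E.
Proof.
elim: n f => [|n IH] f fP.
  have -> : (fun w => \sum_(i < 0) f i w) = cst 0.
    by apply/funext => w; rewrite big_ord0.
  split; first exact: integrable0.
  by under eq_integral => w _ do rewrite big_ord0; rewrite integral0.
have [i1 p1] := IH (fun i => f (widen_ord (leqnSn n) i)) (fun i => fP _).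
have [i2 p2] := fP ord_max.
have split_sum : EFin \o (fun w => \sum_(i < n.+1) f i w) =
    ((EFin \o (fun w => (\sum_(i < n) f (widen_ord (leqnSn n) i) w)%R)) \+
     (EFin \o f ord_max))%E.
  by apply/funext => w; rewrite /= big_ord_recr.
split; first by rewrite split_sum; exact: integrableD.
have -> : (\int[P]_w (\sum_(i < n.+1) f i w)%R%:E =
    \int[P]_w (\sum_(i < n) f (widen_ord (leqnSn n) i) w)%R%:E +
    \int[P]_w (f ord_max w)%:E)%E.
  rewrite -integralD//; apply: eq_integral => w _.
  by rewrite big_ord_recr.
exact: adde_ge0.
Qed.

(** Multipliers are regular only on their domain, so they are cut to zero outside a compact part of
    it before integration. The superlevel sets within [D] are compact, hence Borel. *)
Lemma restrict_continuous_measurable (R : realType) (V : normedModType R)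
    (D : set V) (l : V -> R) : compact D -> {within D, continuous l} ->
  measurable_fun [set: borel V] (l \_ D : borel V -> R).
Proof.
move=> cD cl; have hV : hausdorff_space V by exact: norm_hausdorff.
have mD : measurable (D : set (borel V)).
  by apply: closed_borel; exact: compact_closed.
apply/(measurable_restrictT _ mD).
move=> _; apply: (measurability _ (RGenCInfty.measurableE R)) => // _ [_ [c ->] <-].
have -> : D `&` l @^-1` `[c, +oo[ = D `&` [set x | c <= l x].
  by apply/seteqP; split=> x /=; rewrite in_itv /= andbT.
apply: closed_borel; apply: compact_closed => //.
by apply: compact_superlevel => //; exact: usc_on_continuous.
Qed.

Section necessity.
Context (R : realType) (T k : nat) (tau : R) (b : 'cV[R]_k).
Context (Pobs : probability (borel (obs R T k)) R).
Hypotheses (T_gt0 : (0 < T)%N) (tau0 : 0 < tau) (tau1 : tau < 1)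
  (cW : compact (calW Pobs)).
Context (Ps : probability (borel (struct R T k)) R).
Hypotheses
  (PsW : forall C : set (borel (obs R T k)), measurable C ->
    pushforward Ps (@sW R T k) C = Pobs C)
  (Ps_eq : forall t : 'I_T,
    {ae Ps, forall s, sY s t 0 = (sX s *m b) t 0 + sA s + sU s t 0})
  (Ps_ge : forall t : 'I_T,
    cond_prob_ge Ps (@sXA R T k) [set s | sU s t 0 <= 0] tau)
  (Ps_le : forall t : 'I_T,
    cond_prob_le Ps (@sXA R T k) [set s | sU s t 0 < 0] tau).

Let W := calW Pobs.
Let Kb := K Pobs b.
Let msXA := @continuous_borel_measurable _ _ _ _ (@continuous_sXA R T k).
Let msW := @continuous_borel_measurable _ _ _ _ (@continuous_sW R T k).
Let E1 (t : 'I_T) : set (borel (struct R T k)) := [set s | sU s t 0 <= 0].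
Let E2 (t : 'I_T) : set (borel (struct R T k)) := ~` [set s | sU s t 0 < 0].
Let mE1 t : measurable (E1 t). Proof. exact: measurable_sU_le0. Qed.
Let mE2 t : measurable (E2 t).
Proof. by apply: measurableC; exact: measurable_sU_lt0. Qed.

Let Ps_below t (B : set (borel ('M[R]_(T, k) * R)%type)) : measurable B ->
  (tau%:E * Ps (@sXA R T k @^-1` B) <= Ps (E1 t `&` @sXA R T k @^-1` B))%E.
Proof. by have /(cond_prob_geP Ps msXA (mE1 t)) := Ps_ge t; apply. Qed.

Let Ps_above t (B : set (borel ('M[R]_(T, k) * R)%type)) : measurable B ->
  ((1 - tau)%:E * Ps (@sXA R T k @^-1` B) <= Ps (E2 t `&` @sXA R T k @^-1` B))%E.
Proof.
have /(cond_prob_leP _ _ msXA (measurable_sU_lt0 t)) := Ps_le t.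
by move=> /(cond_prob_geP Ps msXA (mE2 t)); apply.
Qed.

Let residual_eq s := W (sW s) /\
  forall t : 'I_T, residual b (sW s) t = sA s + sU s t 0.

Let residual_eq_ae : {ae Ps, forall s, residual_eq s}.
Proof.
have h1 : {ae Ps, forall s, W (sW s)}.
  have mW := measurable_calW Pobs.
  have mCW : measurable (@sW R T k @^-1` (~` W)).
    by rewrite -[X in measurable X]setTI; apply: msW => //; exact: measurableC.
  exists (@sW R T k @^-1` (~` W)); split=> //.
  have := PsW (measurableC mW); rewrite /pushforward => ->.
  by rewrite probability_setC// calW_full subee.
have h2 : {ae Ps, forall s, forall t : 'I_T,
    sY s t 0 = (sX s *m b) t 0 + sA s + sU s t 0}.
  by apply: filter_forall => t; exact: Ps_eq.
apply: filterS2 h1 h2 => s Ws eqs; split=> // t.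
rewrite -[residual _ _ _]/(sY s t 0 - (sX s *m b) t 0) (eqs t).
lra.
Qed.

(* An interval of values of A on which every residual lies strictly on one side
   is null: a conditional probability bounded away from 0 would be 0 there. *)
Let null_A (E : set (borel (struct R T k))) (c : R)
    (B : set (borel ('M[R]_(T, k) * R)%type)) :
  0 < c -> measurable E -> measurable B ->
  (c%:E * Ps (@sXA R T k @^-1` B) <= Ps (E `&` @sXA R T k @^-1` B))%E ->
  (forall s, residual_eq s -> E s -> ~ B (sXA s)) ->
  {ae Ps, forall s, ~ B (sXA s)}.
Proof.
move=> c0 mE mB cP EB.
have mXB : measurable (@sXA R T k @^-1` B).
  by rewrite -[X in measurable X]setTI; exact: msXA.
have EB0 : Ps (E `&` @sXA R T k @^-1` B) = 0%E.
  apply/negligibleP; first exact: measurableI.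
  by apply: negligibleS residual_eq_ae => s [Es Bs] /= /EB/(_ Es).
apply: (@negligibleS _ _ _ _ (@sXA R T k @^-1` B)).
  by move=> s /= /contrapT.
apply/negligibleP => //; apply/eqP; rewrite eq_le measure_ge0 andbT.
by move: cP; rewrite EB0 pmule_rle0.
Qed.

Let good s := residual_eq s /\ Kb (sA s).

(** One period suffices: when $A$ is below every residual, $U_t\le0$ is impossible, and when $A$ is
    above every residual, $U_t\ge0$ is. Hence [null_A] applies with [tau] and with [1 - tau]. *)
Let good_ae : {ae Ps, forall s, good s}.
Proof.
pose t : 'I_T := Ordinal T_gt0.
have cs : continuous (snd : 'M[R]_(T, k) * R -> R) by move=> x; exact: cvg_snd.
pose Bl : set (borel ('M[R]_(T, k) * R)%type) :=
  [set p | p.2 < inf (residuals Pobs b)].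
pose Bu : set (borel ('M[R]_(T, k) * R)%type) :=
  [set p | sup (residuals Pobs b) < p.2].
have mBl : measurable Bl.
  by have /continuousP/(_ _ (@open_lt R (inf (residuals Pobs b)))) := cs; exact: open_borel.
have mBu : measurable Bu.
  by have /continuousP/(_ _ (@open_gt R (sup (residuals Pobs b)))) := cs; exact: open_borel.
have res_itv s : residual_eq s ->
    inf (residuals Pobs b) <= sA s + sU s t 0 <= sup (residuals Pobs b).
  move=> [Ws <-]; have := residual_K cW b t Ws.
  by rewrite /K /= in_itv.
have hl : {ae Ps, forall s, ~ Bl (sXA s)}.
  apply: null_A tau0 (mE1 t) mBl (Ps_below t mBl) _ => s /res_itv/andP[+ _].
  by rewrite /E1 /Bl /= => h1 h2 h3; lra.
have hu : {ae Ps, forall s, ~ Bu (sXA s)}.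
  have tau1' : 0 < 1 - tau by rewrite subr_gt0.
  apply: null_A tau1' (mE2 t) mBu (Ps_above t mBu) _ => s /res_itv/andP[_].
  by rewrite /E2 /Bu /= => h1 /negP; rewrite -leNgt => h2 h3; lra.
have h := residual_eq_ae; apply: filterS3 h hl hu => s rs nl nu; split=> //.
rewrite /Kb /K /= in_itv /=; apply/andP; split.
  by rewrite leNgt; apply/negP.
by rewrite leNgt; apply/negP.
Qed.

Lemma Psi_ge0_of_structural (lambda : multipliers R T k) :
  admissible Pobs b lambda -> (0 <= Psi Pobs tau b lambda)%E.
Proof.
move=> al; have tau01 : 0 < tau < 1 by rewrite tau0.
have cQ : compact (W `*` Kb) by exact: compact_calW_K.
pose XA (x : obs R T k * R) : 'M[R]_(T, k) * R := (x.1.2, x.2).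
have cXA : continuous XA.
  have c1 : continuous (fun x : obs R T k * R => x.1) by move=> y; exact: cvg_fst.
  have c2 : continuous (fun x : obs R T k * R => x.2) by move=> y; exact: cvg_snd.
  have c3 : continuous (fun w : obs R T k => w.2) by move=> y; exact: cvg_snd.
  exact: (continuous_pairf (continuous_compf c1 c3) c2).
(* This compact part of the multipliers' domain contains $(X,A)$ almost surely, and continuity
   bounds the multipliers on it. *)
pose D := [set XA x | x in W `*` Kb].
have cD : compact D by apply: continuous_compact => //; exact: continuous_subspaceT.
have DX : D `<=` calX Pobs `*` Kb.
  by move=> _ [[w a] [/= Ww Ka] <-]; split=> //; exact: calX_calW.
have sXA_D s : good s -> D (sXA s).
  by move=> [[Ws _] Ks]; exists (sW s, sA s).
have hP (l : 'M[R]_(T, k) * R -> R) :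
    Cplus (calX Pobs `*` Kb) l ->
    measurable_fun [set: borel ('M[R]_(T, k) * R)%type] (l \_ D) /\
    exists C, forall p, 0 <= (l \_ D) p <= C.
  move=> [cl l0]; have cl' := continuous_subspaceW DX cl.
  split; first exact: restrict_continuous_measurable.
  have [C lC] := within_compact_bounded cD cl'.
  exists (Num.max 0 C) => p; rewrite /patch; case: ifPn => [|_].
    rewrite inE => Dp; rewrite l0 /= ?le_max; last exact: DX.
    by rewrite (le_trans (ler_norm _) (lC _ Dp)) orbT.
  by rewrite lexx le_max lexx.
(* On good points the sum of [H t] over [t] equals [Sfun] at $(W,A)$; each [H t] has nonnegative
   mean by the integrated constraints. *)
pose H t s := ((lambda t).1 \_ D) (sXA s) * (\1_(E1 t) s - tau) +
  ((lambda t).2 \_ D) (sXA s) * (\1_(E2 t) s - (1 - tau)).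
have HP t : Ps.-integrable setT (EFin \o H t) /\
    (0 <= \int[Ps]_s (H t s)%:E)%E.
  have [/hP[m1 [C1 b1]] /hP[m2 [C2 b2]]] := al t.
  have [i1 p1] := cond_prob_integral_ge0 msXA (mE1 t) (ltW tau0)
    (fun B => @Ps_below t B) m1 b1.
  have tau1' : 0 <= 1 - tau by rewrite subr_ge0 ltW.
  have [i2 p2] := cond_prob_integral_ge0 msXA (mE2 t) tau1'
    (fun B => @Ps_above t B) m2 b2.
  have -> : EFin \o H t = ((fun s => (((lambda t).1 \_ D) (sXA s) *
      (\1_(E1 t) s - tau))%:E) \+ (fun s => (((lambda t).2 \_ D) (sXA s) *
      (\1_(E2 t) s - (1 - tau)))%:E))%E by apply/funext => s.
  split; first exact: integrableD.
  by under eq_integral => s _ do rewrite EFinD; rewrite integralD//; exact: adde_ge0.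
have [iH H0] := integral_sum_ge0 HP.
pose M w := sup [set Sfun tau b lambda w a | a in Kb].
have mW := measurable_calW Pobs.
pose F : borel (obs R T k) -> \bar R := (EFin \o M) \_ W.
have iM : Pobs.-integrable setT F.
  by apply/(integrable_mkcond _ mW); exact: sup_Sfun_integrable.
have mM : measurable_fun setT F by exact: measurable_int iM.
have iMs : Ps.-integrable setT (F \o @sW R T k).
  apply/integrableP; split; first exact: measurableT_comp.
  have mA : measurable_fun setT (abse \o F).
    exact: measurableT_comp.
  have [_] := integrableP _ _ _ iM; apply: le_lt_trans.
  rewrite le_eqVlt; apply/orP; left; apply/eqP.
  have := ge0_integral_pushforward msW Ps measurableT mA (fun w _ => abse_ge0 _).
  by move=> <-; apply: eq_measure_integral => A mA' AT; by first [exact: PsW|exact: esym (PsW mA')].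
(* Equality of the marginals moves [Psi] to the structural space, where it can be compared pointwise
   with the sum of the [H t]. *)
have PsiE : (Psi Pobs tau b lambda = \int[Ps]_s F (sW s))%E.
  rewrite /Psi integral_mkcond.
  transitivity (\int[pushforward Ps (@sW R T k)]_w F w)%E.
    by apply: eq_measure_integral => A mA AT; by first [exact: PsW|exact: esym (PsW mA)].
  by rewrite integral_pushforward.
rewrite PsiE; apply: le_trans H0 _.
(* Both integrals are taken off a null set containing all bad points, where [Sfun] at [sA s] is
   below its supremum over [K]. *)
have [N [mN N0 goodN]] := good_ae.
rewrite (negligible_integral mN measurableT iH N0).
rewrite (negligible_integral mN measurableT iMs N0).
apply: le_integral.
- exact: measurableD.
- by apply: integrableS iH => //; exact: measurableD.
- by apply: integrableS iMs => //; exact: measurableD.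
move=> s; rewrite inE => -[_ nNs].
have gs : good s by apply: contrapT => ngs; apply: nNs; exact: goodN.
have Ds := sXA_D s gs; have [[Ws rs] Ks] := gs.
rewrite /= /F patchT ?inE//= lee_fin /M.
have := @Sfun_le_sup R T k Pobs cW T_gt0 b tau lambda tau01 al (sW s) (sA s) Ws Ks.
apply: le_trans; rewrite le_eqVlt; apply/orP; left; apply/eqP.
rewrite /Sfun; apply: eq_bigr => t _; rewrite /H !patchT ?inE//.
have e1 : (\1_(E1 t) s : R) = (residual b (sW s) t <= sA s)%R%:R.
  rewrite indicE rs gerDl; congr (_ %:R); congr nat_of_bool.
  by apply/idP/idP; rewrite inE.
have e2 : (\1_(E2 t) s : R) = 1 - (residual b (sW s) t < sA s)%R%:R.
  rewrite indicE rs gtrDl.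
  case: (boolP (s \in E2 t)).
    by rewrite inE /E2 /= => /negP/negPf ->; rewrite subr0.
  by rewrite notin_setE /E2 /= => /contrapT ->; rewrite subrr.
by rewrite e1 e2; congr (_ + _); congr (_ * _); lra.
Qed.

End necessity.

(** * The equivalence, and a violated inequality by contraposition *)

Theorem theorem5p2 (R : realType) (T k : nat) (T_gt0 : (0 < T)%N)
    (k_gt0 : (0 < k)%N) (tau : R) (tau_gt0 : 0 < tau) (tau_lt1 : tau < 1)
    (calB : set 'cV[R]_k) (Pobs : probability (borel (obs R T k)) R)
    (compact_calW : compact (calW Pobs)) (b : 'cV[R]_k) (calB_b : calB b) :
  (identified_set tau calB Pobs b <->
     forall lambda : multipliers R T k, admissible Pobs b lambda ->
       (0 <= Psi Pobs tau b lambda)%E) /\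
  (~ identified_set tau calB Pobs b ->
     exists2 lambda : multipliers R T k, admissible Pobs b lambda &
       (Psi Pobs tau b lambda < 0)%E).
Proof.
have iffP : identified_set tau calB Pobs b <->
    forall lambda : multipliers R T k, admissible Pobs b lambda ->
      (0 <= Psi Pobs tau b lambda)%E.
  split=> [[_ [Ps [PsW Ps_eq Ps_ge Ps_le]]] lambda al|Psi_ge0].
    exact: (Psi_ge0_of_structural T_gt0 tau_gt0 tau_lt1 compact_calW
      PsW Ps_eq Ps_ge Ps_le al).
  have [mu [mu_obs mu_below mu_above]] :=
    coupling_exists T_gt0 tau_gt0 tau_lt1 compact_calW Psi_ge0.
  exact: identified_of_coupling calB_b mu_obs mu_below mu_above.
split=> // nid; apply: contrapT => nex; apply: nid; apply/iffP => lambda al.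
by rewrite leNgt; apply/negP => Psi_lt0; apply: nex; exists lambda.
Qed.
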